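(* Let $u_h=\{u_{hi},u_{hb}\}\in V_h^0$ be the velocity component of a solution $(u_h,p_h)\in V_h^0\times Q_h^0$ of the weak Galerkin scheme (WG) defined in the context. Then $$u_{hi}\in H(\mathrm{div};\Omega)\qquad\text{and}\qquad \nabla\cdot u_{hi}=0 \ \text{ in } \Omega .$$
   Context: $\Omega\subset\mathbb R^n$ ($n\in\{2,3\}$) is a bounded Lipschitz polygonal/polyhedral domain; $\nu>0$, $\alpha>0$, $r\ge2$ are real numbers and $f\in[L^2(\Omega)]^n$. $H(\mathrm{div};\Omega)=\{v\in[L^2(\Omega)]^n:\nabla\cdot v\in L^2(\Omega)\}$; $L^2_0(\Omega)=\{q\in L^2(\Omega):\int_\Omega q=0\}$. Mesh and notation. $\mathcal T_h$ is a shape regular partition of $\Omega$ into closed simplexes, $\mathcal E_h$ is the set of all edges (faces) of its elements, $h_K$ is the diameter of $K\in\mathcal T_h$, and $n$ (or $n_K$) also denotes the outward unit normal on $\partial K$. $(\cdot,\cdot)_D$ is the $L^2(D)$ inner product, $(\cdot,\cdot)=(\cdot,\cdot)_\Omega$, $\langle\cdot,\cdot\rangle_{\partial K}$ the $L^2(\partial K)$ inner product, $\langle\cdot,\cdot\rangle_{\partial\mathcal T_h}=\sum_{K\in\mathcal T_h}\langle\cdot,\cdot\rangle_{\partial K}$. $P_j(D)$ denotes polynomials of degree at most $j$ on $D$. $(u\otimes v)_{ij}=u_iv_j$. Integers $m\ge1$ and $k\in\{m-1,m\}$ are fixed; $\eta|_{\partial K}=h_K^{-1}$; $\Pi_k^B$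 is the (componentwise) $L^2$-projection onto $P_k(e)$ on each $e\in\mathcal E_h$. Discrete weak operators. For an integer $\gamma\ge0$ and $v=\{v_i,v_b\}$ ($v_i$ on element interiors, $v_b$ on element boundaries), $\nabla_{w,\gamma}v|_K\in[P_\gamma(K)]^n$ is defined by $(\nabla_{w,\gamma}v,\varsigma)_K=-(v_i,\nabla\cdot\varsigma)_K+\langle v_b,\varsigma\cdot n\rangle_{\partial K}$ for all $\varsigma\in[P_\gamma(K)]^n$; for vector-valued $v$ it is applied componentwise. For vector-valued $w=\{w_i,w_b\}$, $\nabla_{w,\gamma}\cdot w|_K\in P_\gamma(K)$ is defined by $(\nabla_{w,\gamma}\cdot w,\varsigma)_K=-(w_i,\nabla\varsigma)_K+\langle w_b\cdot n,\varsigma\rangle_{\partial K}$ for all $\varsigma\in P_\gamma(K)$; for tensors it is applied row by row. Discrete spaces. $V_h^0$ is the set of $v_h=\{v_{hi},v_{hb}\}$ with $v_{hi}|_K\in[P_m(K)]^n$ for all $K\in\mathcal T_h$, $v_{hb}|_e\in[P_k(e)]^n$ for all $e\in\mathcal E_h$, and $v_{hb}|_{\partial\Omega}=0$. $Q_h^0$ is the set of $q_h=\{q_{hi},q_{hb}\}$ with $q_{hi}|_K\in P_{m-1}(K)$, $q_{hb}|_e\in P_m(e)$, and $q_{hi}\in L^2_0(\Omega)$. Forms. $a_h(u_h,v_h)=\nu(\nabla_{w,m-1}u_h,\nabla_{w,m-1}v_h)+\nu\langle\eta(\Pi_k^Bu_{hi}-u_{hb}),\Pi_k^Bv_{hi}-v_{hb}\rangle_{\partial\mathcal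 T_h}$, $b_h(v_h,q_h)=(\nabla_{w,m}q_h,v_{hi})$, $c_h(\kappa_h;u_h,v_h)=\alpha(|\kappa_{hi}|^{r-2}u_{hi},v_{hi})$, $d_h(\kappa_h;u_h,v_h)=\tfrac12(\nabla_{w,m}\cdot\{u_{hi}\otimes\kappa_{hi},u_{hb}\otimes\kappa_{hb}\},v_{hi})-\tfrac12(\nabla_{w,m}\cdot\{v_{hi}\otimes\kappa_{hi},v_{hb}\otimes\kappa_{hb}\},u_{hi})$. Scheme (WG): find $(u_h,p_h)\in V_h^0\times Q_h^0$ such that $a_h(u_h,v_h)+b_h(v_h,p_h)+c_h(u_h;u_h,v_h)+d_h(u_h;u_h,v_h)=(f,v_{hi})$ for all $v_h\in V_h^0$, and $b_h(u_h,q_h)=0$ for all $q_h\in Q_h^0$. *)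

(* Defs.v *)
From HB Require Import structures.
From mathcomp Require Import all_boot all_order all_algebra.
From mathcomp Require Import -(notations) mpoly.
From mathcomp Require Import all_classical all_reals all_analysis.
Set Implicit Arguments.
Unset Strict Implicit.
Unset Printing Implicit Defensive.
Import Order.TTheory GRing.Theory Num.Theory.
Import numFieldNormedType.Exports.
Local Open Scope classical_set_scope.
Local Open Scope ring_scope.

(* The Borel sigma-algebra on row vectors, generated by the coordinates, and
   Lebesgue measure on R^n obtained from R^n.+1 = R * R^n. *)
Definition measure_row_display : measure_display -> measure_display.
Proof. exact. Qed.

Section measurable_row.
Context {d} {T : measurableType d}.
Variable n : nat.

Let coors : 'I_n -> 'rV[T]_n -> T := fun i x => x 0 i.

Let row_set0 : g_sigma_preimage coors set0.
Proof. exact: sigma_algebra0. Qed.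

Let row_setC A : g_sigma_preimage coors A -> g_sigma_preimage coors (~` A).
Proof. exact: sigma_algebraC. Qed.

Let row_bigcup (F : _^nat) : (forall i, g_sigma_preimage coors (F i)) ->
  g_sigma_preimage coors (\bigcup_i (F i)).
Proof. exact: sigma_algebra_bigcup. Qed.

HB.instance Definition _ := @isMeasurable.Build (measure_row_display d)
  'rV[T]_n (g_sigma_preimage coors) row_set0 row_setC row_bigcup.

End measurable_row.

Lemma measurable_coord d (T : measurableType d) n (i : 'I_n) :
  measurable_fun [set: 'rV[T]_n] (fun x : 'rV[T]_n => x 0 i).
Proof.
move=> _ Y mY; rewrite setTI; apply: sub_sigma_algebra => /=.
rewrite -bigcup_seq/=; exists i => /=; first by rewrite mem_index_enum.
by exists Y => //; rewrite setTI.
Qed.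

Lemma measurable_fun_rowP d1 d2 (T1 : measurableType d1)
    (T2 : measurableType d2) n (f : T1 -> 'rV[T2]_n) :
  (forall i, measurable_fun setT (fun x => f x 0 i)) -> measurable_fun setT f.
Proof.
move=> mf.
suff H : g_sigma_preimage (fun i (x : T1) => f x 0 i) `<=` measurable.
  move: H; rewrite (g_sigma_preimage_comp (fun i (x : 'rV[T2]_n) => x 0 i) f).
  by move=> H _ A mA; apply: H; exists A.
apply: smallest_sub; first exact: sigma_algebra_measurable.
case: n => [|n] in f mf *; first by rewrite big_ord0.
rewrite -bigcup_mkord_ord; apply: bigcup_sub => i Ii.
by move=> A [B mB <-]; exact: mf.
Qed.

Section lebesgue_rV.
Variable R : realType.

Definition row_cons n (x : measurableTypeR R * 'rV[R]_n) : 'rV[R]_n.+1 :=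
  row_mx (x.1)%:M x.2 :> 'rV[R]_(1 + n).

Lemma row_cons0 n x : @row_cons n x 0 ord0 = x.1.
Proof.
have -> : (ord0 : 'I_(1 + n)) = lshift n (ord0 : 'I_1) by exact/val_inj.
by apply: etrans (row_mxEl _ _ _ _) _; rewrite mxE eqxx.
Qed.

Lemma row_cons_lift n x i : @row_cons n x 0 (lift ord0 i) = x.2 0 i.
Proof.
have -> : lift (ord0 : 'I_(1 + n)) i = rshift 1 i by exact/val_inj.
exact: row_mxEr.
Qed.

Lemma measurable_row_cons n : measurable_fun setT (@row_cons n).
Proof.
apply: measurable_fun_rowP => i; case: (unliftP ord0 i) => [j ->|->].
  under eq_fun do rewrite row_cons_lift.
  exact: (measurableT_comp (measurable_coord j) measurable_snd).
under eq_fun do rewrite row_cons0.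
exact: measurable_fst.
Qed.

HB.instance Definition _ n :=
  isMeasurableFun.Build _ _ _ _ (@row_cons n) (@measurable_row_cons n).

Section lebesgue_rVS.
Local Open Scope ereal_scope.
Variables (n : nat) (mu : {sigma_finite_measure set 'rV[R]_n -> \bar R}).

Definition lebesgue_rVS : set 'rV[R]_n.+1 -> \bar R :=
  pushforward (lebesgue_measure \x mu) (@row_cons n).

Let lebesgue_rVS0 : lebesgue_rVS set0 = 0.
Proof. exact: measure0. Qed.

Let lebesgue_rVS_ge0 A : 0 <= lebesgue_rVS A.
Proof. exact: measure_ge0. Qed.

Let lebesgue_rVS_sigma_additive : semi_sigma_additive lebesgue_rVS.
Proof. exact: measure_semi_sigma_additive. Qed.

HB.instance Definition _ := isMeasure.Build _ _ _ lebesgue_rVS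
  lebesgue_rVS0 lebesgue_rVS_ge0 lebesgue_rVS_sigma_additive.

Let lebesgue_rVS_sigma_finite : sigma_finite setT lebesgue_rVS.
Proof.
pose un (y : 'rV[R]_n.+1) : measurableTypeR R * 'rV[R]_n :=
  (y 0%R ord0, \row_i y 0%R (lift ord0 i)).
have unK : cancel un (@row_cons n).
  move=> y; apply/rowP => i; case: (unliftP ord0 i) => [j ->|->].
    by rewrite row_cons_lift mxE.
  by rewrite row_cons0.
have consK : cancel (@row_cons n) un.
  move=> [a v]; congr pair; rewrite ?row_cons0//.
  by apply/rowP => i; rewrite mxE row_cons_lift.
have mun : measurable_fun setT un.
  apply/measurable_fun_pairP; split; first exact: measurable_coord.
  apply: measurable_fun_rowP => i /=.
  under eq_fun do rewrite mxE.
  exact: measurable_coord.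
have /sigma_finiteP[F [TF ndF Foo]] := sigma_finiteT (@lebesgue_measure R).
have /sigma_finiteP[G [TG ndG Goo]] := sigma_finiteT mu.
exists (fun k => un @^-1` (F k `*` G k)).
  rewrite -preimage_bigcup (_ : \bigcup_k _ = setT) ?preimage_setT//.
  rewrite -subTset -setXTT TF TG => -[x y] [/= [i _ Fx] [j _ Gy]].
  exists (maxn i j) => //; split.
    by move: x Fx; exact/subsetPset/ndF/leq_maxl.
  by move: y Gy; exact/subsetPset/ndG/leq_maxr.
move=> k; have [mF Fk] := Foo k; have [mG Gk] := Goo k; split.
  by rewrite -[X in measurable X]setTI; apply: mun => //; exact: measurableX.
rewrite /lebesgue_rVS /pushforward -comp_preimage.
rewrite (_ : un \o _ = idfun) ?preimage_id; last exact/funext.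
by rewrite product_measure1E// lte_mul_pinfty// ge0_fin_numE.
Qed.

HB.instance Definition _ := Measure_isSigmaFinite.Build _ _ _ lebesgue_rVS
  lebesgue_rVS_sigma_finite.

End lebesgue_rVS.

Fixpoint lebesgue_rV n : {sigma_finite_measure set 'rV[R]_n -> \bar R} :=
  match n with
  | 0 => \d_(0%R : 'rV[R]_0)
  | n.+1 => lebesgue_rVS (lebesgue_rV n)
  end.

End lebesgue_rV.

Section euclid.
Variable R : realType.
Implicit Type n : nat.

(* The norm of the library on 'rV[R]_n is the sup norm; lengths, diameters,
   unit normals and |kappa|^(r-2) need the Euclidean one. *)
Definition dot n (x y : 'rV[R]_n) : R := \sum_i x 0 i * y 0 i.
Definition enorm n (x : 'rV[R]_n) : R := Num.sqrt (dot x x).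

Definition bnd n (D : set 'rV[R]_n) : set 'rV[R]_n := closure D `\` D°.

(* L^2(D) for functions defined on the whole space, of which only the
   restriction to D matters. *)
Definition L2 n (D : set 'rV[R]_n) (g : 'rV[R]_n -> R) : Prop :=
  (g \_ D) \in Lfun (lebesgue_rV R n) 2%:E.
Definition L2v n (D : set 'rV[R]_n) (g : 'rV[R]_n -> 'rV[R]_n) : Prop :=
  forall i, L2 D (fun x => g x 0 i).
Definition L20 n (D : set 'rV[R]_n) (g : 'rV[R]_n -> R) : Prop :=
  L2 D g /\ \int[lebesgue_rV R n]_(x in D) g x = 0.

End euclid.

Section weak_divergence.
Variables (R : realType) (d : nat).
Local Notation V := 'rV[R]_d.+1.
Implicit Types (D : set V) (phi g : V -> R) (v : V -> V).

Definition partial (i : 'I_d.+1) phi : V -> R :=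
  fun x => 'D_(delta_mx 0 i) phi x.
Definition grad phi (x : V) : V := \row_i partial i phi x.

(* C^oo: every iterated partial derivative exists and is continuous. *)
Definition smooth phi : Prop :=
  forall s : seq 'I_d.+1, continuous (foldr partial phi s) /\
    forall x i, derivable (foldr partial phi s) x (delta_mx 0 i).

Definition test_function D phi : Prop :=
  [/\ smooth phi, compact (closure [set x | phi x != 0])
    & closure [set x | phi x != 0] `<=` D].

(* div v = g in D, in the sense of distributions. *)
Definition weak_div D v g : Prop :=
  forall phi, test_function D phi ->
    \int[lebesgue_rV R d.+1]_(x in D) dot (v x) (grad phi x) =
    - \int[lebesgue_rV R d.+1]_(x in D) (g x * phi x).

Definition Hdiv D v : Prop := L2v D v /\ exists2 g, L2 D g & weak_div D v g.

End weak_divergence.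

Section simplexes.
Variables (R : realType) (n : nat).
Local Notation V := 'rV[R]_n.

Definition simplex k (p : 'I_k.+1 -> V) : set V :=
  [set x | exists l : 'I_k.+1 -> R,
    [/\ forall i, 0 <= l i, \sum_i l i = 1 & x = \sum_i l i *: p i]].

Definition edges k (p : 'I_k.+1 -> V) : 'M[R]_(k, n) :=
  \matrix_i (p (lift ord0 i) - p ord0).

Definition nondegenerate k (p : 'I_k.+1 -> V) : Prop := row_free (edges p).

Definition ref_simplex k : set 'rV[R]_k :=
  [set t | (forall i, 0 <= t 0 i) /\ \sum_i t 0 i <= 1].

(* k-dimensional surface integral over the flat simplex with vertices p,
   through its affine parametrization by the reference simplex; the factor is
   the square root of the Gram determinant. *)
Definition simplex_int k (p : 'I_k.+1 -> V) (g : V -> R) : R :=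
  Num.sqrt (\det (edges p *m (edges p)^T)) *
  \int[lebesgue_rV R k]_(t in @ref_simplex k) g (p ord0 + t *m edges p).

End simplexes.

Section domains.
Variables (R : realType) (d : nat).
Local Notation V := 'rV[R]_d.+1.
Implicit Type D : set V.

(* Near each boundary point, in suitable orthonormal coordinates
   z = y *m Q, D is the strict epigraph z_0 > g (z_1, ..., z_d) of a Lipschitz
   function. *)
Definition lipschitz_boundary D : Prop :=
  forall x, bnd D x -> exists (Q : 'M[R]_d.+1) (g : 'rV[R]_d -> R) (L e : R),
    [/\ Q *m Q^T = 1%:M, L.-lipschitz g, 0 < e
      & forall y, enorm (y - x) < e ->
          (D y <-> g (col' ord0 (y *m Q)) < (y *m Q) 0 ord0)].

Definition polyhedral D : Prop :=
  exists N (p : 'I_N -> 'I_d.+2 -> V),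
    (forall i, nondegenerate (p i)) /\ closure D = \bigcup_i simplex (p i).

Definition lipschitz_polyhedral_domain D : Prop :=
  [/\ open D, connected D & D !=set0] /\
  [/\ bounded_set D, lipschitz_boundary D & polyhedral D].

End domains.

(* The space dimension is d+1, so an element has d+2 vertices. *)
Record mesh (R : realType) (d : nat) := Mesh {
  cell : finType;
  vtx : cell -> 'I_d.+2 -> 'rV[R]_d.+1 }.

Section meshes.
Variables (R : realType) (d : nat) (T : mesh R d).
Local Notation V := 'rV[R]_d.+1.
Local Notation cell := (cell T).
Implicit Types (K : cell) (j : 'I_d.+2).

Definition elt K : set V := simplex (vtx K).

(* Face-to-face conformity is not required: a face is a set, and two elements
   share a face when they have the same set as a face. *)
Definition partitions (D : set V) : Prop :=
  [/\ forall K, nondegenerate (vtx K), \bigcup_K elt K = closure D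
    & forall K K', K != K' -> (elt K)° `&` (elt K')° = set0].

(* The face of K opposite to its j-th vertex. *)
Definition fvtx K j : 'I_d.+1 -> V := fun i => vtx K (lift j i).
Definition face K j : set V := simplex (fvtx K j).
Definition faces : set (set V) := [set e | exists K j, e = face K j].

Definition diam K : R :=
  sup [set r | exists x y, [/\ elt K x, elt K y & r = enorm (x - y)]].
(* Diameter of the largest ball inscribed in K. *)
Definition inball_diam K : R :=
  sup [set r | exists c s, [/\ 0 < s, [set y | enorm (y - c) <= s] `<=` elt K
                             & r = 2 * s]].
Definition shape_regular (sigma : R) : Prop :=
  forall K, diam K <= sigma * inball_diam K.

(* Outward unit normal to K on its j-th face. *)
Definition outward_normal K j : V :=
  get [set nu : V | [/\ enorm nu = 1,
    forall x y, face K j x -> face K j y -> dot nu (x - y) = 0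
    & forall x, face K j x -> dot nu (vtx K j - x) < 0]].

Definition cell_int K (g : V -> R) : R :=
  \int[lebesgue_rV R d.+1]_(x in elt K) g x.
(* Integral over the boundary of K; g j is the integrand on the j-th face. *)
Definition bnd_int K (g : 'I_d.+2 -> V -> R) : R :=
  \sum_j simplex_int (fvtx K j) (g j).

(* The almost everywhere defined function that is g K on the interior of K;
   it is set to 0 on the faces, a null set, so as to be Borel measurable. *)
Definition piecewise (W : zmodType) (g : cell -> V -> W) (x : V) : W :=
  if [pick K | `[< (elt K)° x >]] is Some K then g K x else 0.

End meshes.

Section polynomials.
Variables (R : realType) (d : nat).
Local Notation V := 'rV[R]_d.+1.
Local Notation poly := (mpoly.mpoly d.+1 R).

Definition deg_le j (p : poly) : Prop := (mpoly.mmeasure (@mpoly.mdeg d.+1) p <= j.+1)%N.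
Definition peval (p : poly) (x : V) : R := mpoly.meval (fun i => x 0 i) p.
Definition pderiv (i : 'I_d.+1) (p : poly) : poly := mpoly.mderiv i p.

(* g belongs to P_j(D); for D a face, polynomials in the ambient coordinates
   restrict to the same functions as polynomials in coordinates on D. *)
Definition polyOn j (D : set V) (g : V -> R) : Prop :=
  exists2 p, deg_le j p & forall x, D x -> g x = peval p x.

Definition vdeg_le j (p : 'rV[poly]_d.+1) : Prop := forall i, deg_le j (p 0 i).
Definition vpeval (p : 'rV[poly]_d.+1) (x : V) : V := \row_i peval (p 0 i) x.
Definition pdiv (p : 'rV[poly]_d.+1) : poly := \sum_i pderiv i (p 0 i).
Definition pgrad (p : poly) : 'rV[poly]_d.+1 := \row_i pderiv i p.

End polynomials.

(* {v_i, v_b}: v_i on each element, v_b on each face (only the values of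
   wb at members of faces T matter), so that v_b is single-valued on a face
   shared by two elements. *)
Record wfun (R : realType) (d : nat) (T : mesh R d) (W : Type) := Wfun {
  wi : cell T -> 'rV[R]_d.+1 -> W;
  wb : set 'rV[R]_d.+1 -> 'rV[R]_d.+1 -> W }.

Section weak_galerkin.
Variables (R : realType) (d : nat) (T : mesh R d).
Local Notation V := 'rV[R]_d.+1.
Local Notation poly := (mpoly.mpoly d.+1 R).
Local Notation cell := (cell T).
Implicit Types (K : cell) (u v kappa : wfun T V) (q : wfun T R).

(* The weak operators and the projection are determined by their defining
   property, being Riesz representatives in finite-dimensional spaces (for the
   projection, as functions on the face). *)
Definition wgrad (gamma : nat) q K : 'rV[poly]_d.+1 :=
  xget 0 [set G | vdeg_le gamma G /\ forall s, vdeg_le gamma s ->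
    cell_int K (fun x => dot (vpeval G x) (vpeval s x)) =
    - cell_int K (fun x => wi q K x * peval (pdiv s) x)
    + bnd_int K (fun j x =>
        wb q (face K j) x * dot (vpeval s x) (outward_normal K j))].

Definition wdiv (gamma : nat) v K : poly :=
  xget 0 [set D | deg_le gamma D /\ forall s, deg_le gamma s ->
    cell_int K (fun x => peval D x * peval s x) =
    - cell_int K (fun x => dot (wi v K x) (vpeval (pgrad s) x))
    + bnd_int K (fun j x =>
        dot (wb v (face K j) x) (outward_normal K j) * peval s x)].

Definition wcomp v (i : 'I_d.+1) : wfun T R :=
  Wfun (fun K x => wi v K x 0 i) (fun e x => wb v e x 0 i).

(* i-th row of {u_i (x) kappa_i, u_b (x) kappa_b}. *)
Definition tensor_row u kappa (i : 'I_d.+1) : wfun T V :=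
  Wfun (fun K x => wi u K x 0 i *: wi kappa K x)
       (fun e x => wb u e x 0 i *: wb kappa e x).
Definition wdiv_tensor (gamma : nat) u kappa K (x : V) : V :=
  \row_i peval (wdiv gamma (tensor_row u kappa i) K) x.

Definition face_proj (k : nat) (p : 'I_d.+1 -> V) (g : V -> R) : poly :=
  xget 0 [set h | deg_le k h /\ forall s, deg_le k s ->
    simplex_int p (fun x => peval h x * peval s x) =
    simplex_int p (fun x => g x * peval s x)].
Definition face_projv (k : nat) (p : 'I_d.+1 -> V) (g : V -> V) (x : V) : V :=
  \row_i peval (face_proj k p (fun y => g y 0 i)) x.

Variable Omega : set V.

Definition Vh0 (m k : nat) v : Prop :=
  [/\ forall K i, polyOn m (elt K) (fun x => wi v K x 0 i),
      forall e i, faces T e -> polyOn k e (fun x => wb v e x 0 i)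
    & forall e, faces T e -> e `<=` bnd Omega -> forall x, e x -> wb v e x = 0].

Definition Qh0 (m : nat) q : Prop :=
  [/\ forall K, polyOn m.-1 (elt K) (wi q K),
      forall e, faces T e -> polyOn m e (wb q e)
    & L20 Omega (piecewise (wi q))].

Definition inner (g h : cell -> V -> V) : R :=
  \int[lebesgue_rV R d.+1]_(x in Omega) dot (piecewise g x) (piecewise h x).

Definition ah (nu : R) (m k : nat) u v : R :=
  nu * (\sum_i inner (fun K => vpeval (wgrad m.-1 (wcomp u i) K))
                     (fun K => vpeval (wgrad m.-1 (wcomp v i) K)))
  + nu * (\sum_K bnd_int K (fun j x => (diam K)^-1 *
      dot (face_projv k (fvtx K j) (wi u K) x - wb u (face K j) x)
          (face_projv k (fvtx K j) (wi v K) x - wb v (face K j) x))).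

Definition bh (m : nat) v q : R :=
  inner (fun K => vpeval (wgrad m q K)) (wi v).

(* 0 `^ 0 = 1, so that |kappa|^(r-2) = 1 everywhere when r = 2. *)
Definition ch (alpha r : R) kappa u v : R :=
  alpha * inner (fun K x => enorm (wi kappa K x) `^ (r - 2) *: wi u K x)
                (wi v).

Definition dh (m : nat) kappa u v : R :=
  2^-1 * inner (wdiv_tensor m u kappa) (wi v)
  - 2^-1 * inner (wdiv_tensor m v kappa) (wi u).

Definition WG_solution (nu alpha r : R) (f : V -> V) (m k : nat) u
    (p : wfun T R) : Prop :=
  [/\ Vh0 m k u, Qh0 m p,
      forall v, Vh0 m k v ->
        ah nu m k u v + bh m v p + ch alpha r u u v + dh m u u v =
        \int[lebesgue_rV R d.+1]_(x in Omega) dot (f x) (piecewise (wi v) x)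
    & forall q, Qh0 m q -> bh m u q = 0].

End weak_galerkin.

(* Main.v *)
Require Import Defs.
From mathcomp Require Import all_boot all_order all_fingroup all_algebra.
From mathcomp Require Import -(notations) mpoly.
From mathcomp Require Import ring lra.
From mathcomp Require Import all_classical all_reals all_analysis measurable_realfun.
Set Implicit Arguments.
Unset Strict Implicit.
Unset Printing Implicit Defensive.
Import Order.TTheory GRing.Theory Num.Theory.
Import numFieldNormedType.Exports.
Local Open Scope classical_set_scope.
Local Open Scope ring_scope.

(* Integrating the defining relation of the discrete gradient against the
   polynomial u_hi gives, for q in Q_h^0,
     b_h(u_h, q) = sum_K ( - (q_i, div u_hi)_K + <q_b, u_hi . n>_{dK} ).
   Taking q_i = 0 and q_b the jump of the normal component of u_hi across each
   face (its one-sided value on a face belonging to a single element) shows that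
   these jumps vanish. Hence div u_hi has mean zero, so q_i = div u_hi, q_b = 0
   is admissible, and div u_hi = 0 on each element. For a test function phi,
   elementwise integration by parts then gives (u_hi, grad phi) = 0.
   The weak gradient exists as a Riesz representative because the right-hand side
   of its definition vanishes on polynomials that vanish on K. The divergence
   theorem on a simplex is reduced, by a linear change of variables for the
   iterated Lebesgue measure, to the fundamental theorem of calculus in one edge
   direction of the reference simplex. *)

(** * Lebesgue measure on row vectors *)

(** The order of the two tests is forced: pressure test functions must have mean zero, and the
    divergence of u_hi is known to have mean zero only once the jumps vanish. Since q_b is not
    constrained on the boundary of [Omega], the first test also kills the normal trace of u_hi on
    boundary faces. The degrees match: u_hi has degree m, so it may be tested against [wgrad m] and
    its normal component is an admissible q_b, while its divergence has degree m - 1, as q_i must.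

    Faces are compared as sets and conformity is not assumed, so the number of incidences (element,
    face index) carrying one face is not fixed in advance; sums over incidences weighted by the
    inverse multiplicity replace the usual pairing of two neighbours.

    Surface integrals are defined through Gram determinants. They enter the divergence theorem by
    algebra alone: the Gram factor of a face times the height over it is the determinant of the
    simplex.

    The Lipschitz boundary serves to show that [Omega] fills the interior of its closure, so that
    the interior of every element lies in [Omega]. *)

Section box.
Variables (R : realType) (n : nat).

Definition box (c : 'rV[R]_n) (e : R) : set 'rV[R]_n :=
  [set x | forall i, ball (c 0 i) e (x 0 i)].

Lemma boxE c e : 0 < e -> box c e = ball c e.
Proof.
move=> e0; apply/seteqP; split => [x cx|x [_ cx]] //.
  by split=> // i j; rewrite (ord1 i); exact: cx.
Qed.

Lemma measurable_box c e : measurable (box c e).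
Proof.
rewrite (_ : box c e = \bigcap_(i in [set: 'I_n])
    ((fun x : 'rV[R]_n => x 0 i) @^-1` (ball (c 0 i) e))).
  apply: fin_bigcap_measurable; first exact: finite_finset.
  move=> i _; rewrite -[X in measurable X]setTI.
  by apply: (measurable_coord i) => //; exact: measurable_ball.
by apply/seteqP; split=> [x cx i _|x cx i]; exact: cx.
Qed.

(** The sigma-algebra is generated by the coordinates, so an open set is recovered as the countable
    union of the boxes with rational centre and radius 1 / (k + 1) that it contains. *)
Lemma open_measurable_rV (A : set 'rV[R]_n) : open A -> measurable A.
Proof.
move=> oA.
pose q2r (q : 'rV[rat]_n) : 'rV[R]_n := map_mx (@ratr R) q.
pose F (qk : 'rV[rat]_n * nat) : set 'rV[R]_n :=
  if `[< box (q2r qk.1) qk.2.+1%:R^-1 `<=` A >]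
  then box (q2r qk.1) qk.2.+1%:R^-1 else set0.
rewrite (_ : A = \bigcup_qk F qk).
  apply: countable_bigcupT_measurable; first exact: countableP.
  by move=> qk; rewrite /F; case: ifP => _; [exact: measurable_box|].
apply/seteqP; split=> [x Ax|x [qk _]]; last first.
  by rewrite /F; case: ifPn => [/asboolP|//]; exact.
have /nbhs_ballP[e /= e0 xeA] : nbhs x A by exact: open_nbhs_nbhs.
have [k ke] : exists k, (k.+1%:R^-1 : R) < e / 2.
  have /cvgrPdist_lt/(_ (e / 2)) := @cvg_harmonic R.
  rewrite divr_gt0// => /(_ isT)[k _ /(_ k (leqnn k))] /=.
  by rewrite sub0r normrN ger0_norm//; exists k.
have k0 : (0 : R) < k.+1%:R^-1 by rewrite invr_gt0.
have /choice[q qP] : forall i, exists q : rat,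
    ball (x 0 i) k.+1%:R^-1 (ratr q : R).
  move=> i; have [|q] := @rat_in_itvoo R (x 0 i - k.+1%:R^-1) (x 0 i + k.+1%:R^-1).
    by rewrite ltrD2l; rewrite (lt_trans _ k0)// oppr_lt0.
  by rewrite in_itv/= => qx; exists q; rewrite /ball/= distrC ltr_distl.
exists ((\row_i q i), k) => //; rewrite /F.
have mE i : q2r (\row_i q i) 0 i = ratr (q i) by rewrite !mxE.
case: ifPn => [_ i|/asboolP].
  by rewrite mE; apply: ball_sym; exact: qP.
move=> nA; exfalso; apply: nA => y yq; apply: xeA; split=> // i j; rewrite (ord1 i).
apply: (@le_ball _ _ _ (e / 2 + e / 2)); first by rewrite -splitr.
have h1 := le_ball (ltW ke) (qP j).
have h2 := yq j; rewrite mE in h2.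
exact: (ball_triangle h1 (le_ball (ltW ke) h2)).
Qed.

Lemma closed_measurable_rV (A : set 'rV[R]_n) : closed A -> measurable A.
Proof.
move=> cA; rewrite -[A]setCK; apply: measurableC.
by apply: open_measurable_rV; exact: closed_openC.
Qed.

Lemma continuous_measurable_rV (g : 'rV[R]_n -> R) :
  continuous g -> measurable_fun setT g.
Proof.
move=> cg; apply: (measurability _ (@RGenOpens.measurableE R)).
move=> _ [_ [a [b ->]] <-]; rewrite setTI; apply: open_measurable_rV.
by apply: open_comp => //; exact: interval_open.
Qed.

End box.

Lemma lebesgue_box (R : realType) n (c : 'rV[R]_n) (e : R) : 0 <= e ->
  lebesgue_rV R n (box c e) = ((e *+ 2) ^+ n)%:E.
Proof.
move=> e0; elim: n c => [|n IH] c.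
  by rewrite expr0 /= diracE mem_set// => -[].
rewrite /= /lebesgue_rVS /pushforward.
rewrite (_ : _ @^-1` _ = ball (c 0 ord0) e `*` box (\row_i c 0 (lift ord0 i)) e).
  rewrite product_measure1E//; last exact: measurable_box.
    by rewrite IH [X in (X * _)%E]lebesgue_measure_ball// -EFinM exprS.
  exact: measurable_ball.
apply/seteqP; split=> [[a v] H|[a v] [H1 H2] i].
  split => [|i]; first by have := H ord0; rewrite row_cons0.
  by have := H (lift ord0 i); rewrite row_cons_lift mxE.
case: (unliftP ord0 i) => [j ->|->]; last by rewrite row_cons0.
by rewrite row_cons_lift; have := H2 j; rewrite mxE.
Qed.

Section affine_line.
Local Open Scope ereal_scope.
Variable R : realType.
Let mu := @lebesgue_measure R.

Lemma measurable_affine (a b : R) :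
  measurable_fun setT (fun x : measurableTypeR R => (a * x + b)%R : measurableTypeR R).
Proof.
apply: measurable_funD; last exact: measurable_cst.
by apply: measurable_funM; [exact: measurable_cst|exact: measurable_id].
Qed.

(** Both sides are measures in [A], so agreement on half-open intervals is enough. For a < 0 the
    preimage is half-open at the other end, which leaves its length unchanged. *)
Lemma lebesgue_measure_affine (a b : R) A : a != 0%R -> measurable A ->
  mu A = (`|a|%R)%:E * mu ((fun x => a * x + b)%R @^-1` A).
Proof.
move=> a0 mA.
pose pm : {measure set (measurableTypeR R) -> \bar R} :=
  measure_function_pushforward__canonical__measure_function_Measure
    mu (measurable_affine a b).
pose m := mscale (NngNum (normr_ge0 a)) pm.
rewrite (_ : _ * _ = m A)//; apply: lebesgue_measure_unique => //.
move=> _ [[l u] _ <-] /=.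
rewrite /m /mscale /= /pushforward /=.
have [a_gt0|a_lt0|aE] := ltgtP 0%R a; last by rewrite aE eqxx in a0.
- rewrite (_ : _ @^-1` _ = `](l - b) / a, (u - b) / a]%classic)%R; last first.
    apply/seteqP; split=> x /=; rewrite !in_itv/= ltr_pdivrMr// ler_pdivlMr//;
    by rewrite ltrBlDr lerBrDr mulrC.
  rewrite !lebesgue_measure_itv/= !lte_fin ltr_pM2r ?invr_gt0// ltrD2r.
  case: ifP => _; last by rewrite mule0.
  rewrite -!EFinB -EFinM gtr0_norm//; congr EFin.
  by field.
- rewrite (_ : _ @^-1` _ = `[(u - b) / a, (l - b) / a[%classic)%R; last first.
    apply/seteqP; split=> x /=; rewrite !in_itv/= ltr_ndivlMr// ler_ndivrMr//;
    by rewrite andbC ltrBlDr lerBrDr mulrC.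
  rewrite !lebesgue_measure_itv/= !lte_fin ltr_nM2r ?invr_lt0// ltrD2r.
  case: ifP => _; last by rewrite mule0.
  rewrite -!EFinB -EFinM ltr0_norm//; congr EFin.
  by field.
Qed.

Lemma ge0_integral_affine (a b : R) (f : R -> \bar R) : a != 0%R ->
  measurable_fun setT f -> (forall x, 0 <= f x) ->
  \int[mu]_x f x = (`|a|%R)%:E * \int[mu]_x f (a * x + b)%R.
Proof.
move=> a0 mf f0.
pose pm : {measure set (measurableTypeR R) -> \bar R} :=
  measure_function_pushforward__canonical__measure_function_Measure
    mu (measurable_affine a b).
rewrite (_ : \int[mu]_x f (a * x + b)%R = \int[pm]_x f x).
  rewrite -[in RHS](ge0_integral_mscale pm measurableT (NngNum (normr_ge0 a)))//.
  apply: eq_measure_integral => A mA _.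
  exact: lebesgue_measure_affine.
by rewrite /pm [RHS](ge0_integral_pushforward (measurable_affine a b)).
Qed.

End affine_line.

Section lebesgue_rV_linear.
Local Open Scope ereal_scope.
Variable R : realType.
Local Notation mu := (lebesgue_rV R).

Lemma measurable_mulmxD m n (M : 'M[R]_(m, n)) (c : 'rV[R]_n) :
  measurable_fun setT (fun x : 'rV[R]_m => x *m M + c)%R.
Proof.
apply: measurable_fun_rowP => i.
under eq_fun do rewrite !mxE.
apply: measurable_funD; last exact: measurable_cst.
apply: measurable_sum => j; apply: measurable_funM => //.
exact: measurable_coord.
Qed.

Lemma measurable_mulmx m n (M : 'M[R]_(m, n)) :
  measurable_fun setT (fun x : 'rV[R]_m => x *m M)%R.
Proof.
by have := measurable_mulmxD M 0; under eq_fun do rewrite addr0.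
Qed.

Variable n : nat.
Implicit Types f : 'rV[R]_n.+1 -> \bar R.

(** Both orders of integration are provided: a shear that moves the tail by a multiple of the head
    is a translation of the inner variable in this order, and one that moves the head by a linear
    form of the tail is a translation of the inner variable in the other order. *)
Lemma ge0_integral_rVS f : measurable_fun setT f -> (forall x, 0 <= f x) ->
  \int[mu n.+1]_x f x =
  \int[lebesgue_measure]_a \int[mu n]_v f (row_cons (a, v)).
Proof.
move=> mf f0; rewrite [LHS](ge0_integral_pushforward (@measurable_row_cons R n))//.
rewrite preimage_setT (fubini_tonelli1 (f \o @row_cons R n))//; last by move=> x; exact: f0.
by apply: measurableT_comp => //; exact: measurable_row_cons.
Qed.

Lemma ge0_integral_rVS2 f : measurable_fun setT f -> (forall x, 0 <= f x) ->
  \int[mu n.+1]_x f x =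
  \int[mu n]_v \int[lebesgue_measure]_a f (row_cons (a, v)).
Proof.
move=> mf f0; rewrite [LHS](ge0_integral_pushforward (@measurable_row_cons R n))//.
rewrite preimage_setT (fubini_tonelli2 (f \o @row_cons R n))//; last by move=> x; exact: f0.
by apply: measurableT_comp => //; exact: measurable_row_cons.
Qed.

End lebesgue_rV_linear.

(** * Change of variables for invertible linear maps *)

Section change_of_variables.
Local Open Scope ereal_scope.
Variable R : realType.
Local Notation mu := (lebesgue_rV R).

Lemma measurable_comp_mulmxD n (f : 'rV[R]_n -> \bar R) (M : 'M[R]_n) c :
  measurable_fun setT f -> measurable_fun setT (fun x : 'rV[R]_n => f (x *m M + c)%R).
Proof. by move=> mf; exact: (measurableT_comp mf (measurable_mulmxD M c)). Qed.

Lemma measurable_comp_mulmx n (f : 'rV[R]_n -> \bar R) (M : 'M[R]_n) :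
  measurable_fun setT f -> measurable_fun setT (fun x : 'rV[R]_n => f (x *m M)%R).
Proof. by move=> mf; exact: (measurableT_comp mf (measurable_mulmx M)). Qed.

Lemma row_consD n a b (v w : 'rV[R]_n) :
  row_cons ((a + b)%R, (v + w)%R) = (row_cons (a, v) + row_cons (b, w))%R.
Proof.
apply/rowP => i; rewrite [RHS]mxE; case: (unliftP ord0 i) => [j ->|->].
  by rewrite !row_cons_lift mxE.
by rewrite !row_cons0.
Qed.

Lemma row_consE n (v : 'rV[R]_n.+1) :
  v = row_cons (v 0%R ord0, \row_i v 0%R (lift ord0 i)).
Proof.
apply/rowP => i; case: (unliftP ord0 i) => [j ->|->].
  by rewrite row_cons_lift mxE.
by rewrite row_cons0.
Qed.

Lemma ge0_integral_rV_shift n (f : 'rV[R]_n -> \bar R) (c : 'rV[R]_n) :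
  measurable_fun setT f -> (forall x, 0 <= f x) ->
  \int[mu n]_x f x = \int[mu n]_x f (x + c)%R.
Proof.
elim: n f c => [|n IH] f c mf f0.
  by apply: eq_integral => x _; congr f; apply/rowP => -[].
have mfc : measurable_fun setT (fun x : 'rV[R]_n.+1 => f (x + c)%R).
  by have := measurable_comp_mulmxD 1%:M c mf; under eq_fun do rewrite mulmx1.
rewrite ge0_integral_rVS// [RHS]ge0_integral_rVS//.
transitivity (\int[lebesgue_measure]_a \int[mu n]_v f (row_cons (a + c 0 ord0, v)%R)).
  pose F a := \int[mu n]_v f (row_cons (a, v)).
  have mF : measurable_fun setT F.
    apply: (measurable_fun_fubini_tonelli_F (f \o @row_cons R n)).
      by apply: measurableT_comp => //; exact: measurable_row_cons.
    by move=> x; exact: f0.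
  have := @ge0_integral_affine R 1%R (c 0%R ord0) F (oner_neq0 _) mF.
  rewrite /F => ->; last by move=> x; exact: integral_ge0.
  by rewrite normr1 mul1e; under eq_integral do rewrite mul1r.
apply: eq_integral => a _.
rewrite (IH _ (\row_i c 0%R (lift ord0 i))%R); first last.
- by move=> v; exact: f0.
- apply: (measurableT_comp (f := fun av => f (row_cons av)) (g := pair _)) => //.
  by apply: measurableT_comp => //; exact: measurable_row_cons.
by apply: eq_integral => v _; rewrite row_consD -row_consE.
Qed.

(* Change of variables for x |-> x *m M, as a property of M: it is stable
   under products and holds for the factors of a block LU decomposition. *)
Definition lebesgue_scales n (M : 'M[R]_n) : Prop :=
  forall f : 'rV[R]_n -> \bar R, measurable_fun setT f -> (forall x, 0 <= f x) ->
  \int[mu n]_x f x = (`|\det M|%R)%:E * \int[mu n]_x f (x *m M)%R.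

Lemma lebesgue_scalesM n (M N : 'M[R]_n) :
  lebesgue_scales M -> lebesgue_scales N -> lebesgue_scales (M *m N).
Proof.
move=> sM sN f mf f0; rewrite (sN _ mf f0) (sM (fun x : 'rV[R]_n => f (x *m N)%R))//.
- by rewrite muleA -EFinM det_mulmx normrM mulrC; under eq_integral do rewrite -mulmxA.
- exact: measurable_comp_mulmx.
Qed.

Lemma row_cons_block n (a b : R) (c : 'cV[R]_n) (r v : 'rV[R]_n) (D : 'M[R]_n) :
  (row_cons (a, v) *m (block_mx b%:M r c D : 'M[R]_(1 + n)))%R =
  row_cons (a * b + (v *m c) 0%R 0%R, a *: r + v *m D)%R.
Proof.
have H := mul_row_block (a%:M : 'M[R]_1) v (b%:M : 'M[R]_1) r c D.
apply: etrans H _; rewrite /row_cons /=.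
rewrite -scalar_mxM mul_scalar_mx.
by rewrite {1}[(v *m c)%R]mx11_scalar raddfD.
Qed.

Variable n : nat.

Let measurable_sec1 (f : 'rV[R]_n.+1 -> \bar R) : measurable_fun setT f ->
  forall a, measurable_fun setT (fun v => f (row_cons (a, v))).
Proof.
move=> mf a.
apply: (measurableT_comp (f := fun av => f (row_cons av)) (g := pair a)) => //.
by apply: measurableT_comp => //; exact: measurable_row_cons.
Qed.

Let measurable_sec2 (f : 'rV[R]_n.+1 -> \bar R) : measurable_fun setT f ->
  forall v, measurable_fun setT (fun a : measurableTypeR R => f (row_cons (a, v))).
Proof.
move=> mf v.
apply: (measurableT_comp (f := fun av => f (row_cons av)) (g := fun a => (a, v))) => //.
by apply: measurableT_comp => //; exact: measurable_row_cons.
Qed.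

Lemma lebesgue_scales_lower (c : 'cV[R]_n) :
  lebesgue_scales (block_mx 1%:M 0 c 1%:M : 'M[R]_(1 + n)).
Proof.
move=> f mf f0.
have detE : \det (block_mx 1%:M 0 c 1%:M : 'M[R]_(1 + n)) = 1%R.
  by rewrite det_lblock !det1 mulr1.
rewrite detE normr1 mul1e ge0_integral_rVS2// [RHS]ge0_integral_rVS2//; last first.
  exact: measurable_comp_mulmx.
apply: eq_integral => v _.
rewrite (@ge0_integral_affine _ 1%R ((v *m c) 0%R 0%R)%R)//; last first.
  exact: measurable_sec2.
rewrite normr1 mul1e; apply: eq_integral => a _.
by rewrite row_cons_block scaler0 add0r mulmx1 mulr1 mul1r.
Qed.

Lemma lebesgue_scales_upper (r : 'rV[R]_n) :
  lebesgue_scales (block_mx 1%:M r 0 1%:M : 'M[R]_(1 + n)).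
Proof.
move=> f mf f0.
have detE : \det (block_mx 1%:M r 0 1%:M : 'M[R]_(1 + n)) = 1%R.
  by rewrite det_ublock !det1 mulr1.
rewrite detE normr1 mul1e ge0_integral_rVS// [RHS]ge0_integral_rVS//; last first.
  exact: measurable_comp_mulmx.
apply: eq_integral => a _.
rewrite (@ge0_integral_rV_shift _ _ (a *: r)%R)//; last exact: measurable_sec1.
apply: eq_integral => v _.
by rewrite row_cons_block mulmx0 mxE addr0 mulmx1 mulr1 addrC.
Qed.

Lemma lebesgue_scales_diag (a : R) (S : 'M[R]_n) : a != 0%R ->
  lebesgue_scales S ->
  lebesgue_scales (block_mx a%:M 0 0 S : 'M[R]_(1 + n)).
Proof.
move=> a0 sS f mf f0.
have detE : \det (block_mx a%:M 0 0 S : 'M[R]_(1 + n)) = (a * \det S)%R.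
  by rewrite det_ublock det_scalar1.
have mg : measurable_fun setT (fun x : 'rV[R]_n.+1 =>
    f (x *m (block_mx 1%:M 0 0 S : 'M[R]_(1 + n)))%R).
  exact: measurable_comp_mulmx.
rewrite detE normrM EFinM ge0_integral_rVS// [in RHS]ge0_integral_rVS2//; last first.
  exact: measurable_comp_mulmx.
transitivity ((`|\det S|%R)%:E * \int[lebesgue_measure]_b \int[mu n]_v
    f (row_cons (b, v *m S))%R).
  rewrite -ge0_integralZl//; last 2 first.
  - apply: (measurable_fun_fubini_tonelli_F (fun av : measurableTypeR R * 'rV[R]_n => f (row_cons (av.1, av.2 *m S))%R)).
      have /= := measurableT_comp mg (@measurable_row_cons R n).
      apply: eq_measurable_fun => -[b v] _ /=.
      by rewrite row_cons_block mulmx0 mxE addr0 mulr1 scaler0 add0r.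
    by move=> x; exact: f0.
  - by move=> b _; exact: integral_ge0.
  apply: eq_integral => b _; apply: sS => //; exact: measurable_sec1.
rewrite [in RHS](muleC (`|a|)%:E) -muleA; congr (_ * _).
have mh : measurable_fun setT (fun av : measurableTypeR R * 'rV[R]_n =>
    f (row_cons (av.1, av.2 *m S))%R).
  have /= := measurableT_comp mg (@measurable_row_cons R n).
  apply: eq_measurable_fun => -[b v] _ /=.
  by rewrite row_cons_block mulmx0 mxE addr0 mulr1 scaler0 add0r.
(* The tail has been rescaled; exchanging the integrals makes the head the inner variable, where the
   one-dimensional scaling by [a] applies. *)
rewrite (fubini_tonelli _ mh)/=; last by move=> x; exact: f0.
have mh' : measurable_fun setT (fun av : measurableTypeR R * 'rV[R]_n =>
    f (row_cons av *m (block_mx a%:M 0 0 S : 'M[R]_(1 + n)))%R).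
  have := measurable_comp_mulmx (block_mx a%:M 0%R 0%R S : 'M[R]_(1 + n)) mf.
  by move/measurableT_comp; apply; exact: measurable_row_cons.
rewrite -ge0_integralZl//; last 2 first.
- apply: (measurable_fun_fubini_tonelli_G _ mh').
  by move=> x; exact: f0.
- by move=> v _; exact: integral_ge0.
apply: eq_integral => v _.
rewrite (@ge0_integral_affine _ a 0%R)//; last exact: (measurable_sec2 mf (v *m S)%R).
congr (_ * _); apply: eq_integral => b _.
by rewrite row_cons_block mulmx0 mxE addr0 addr0 scaler0 add0r mulrC.
Qed.

End change_of_variables.

(** Gaussian elimination by induction on the dimension. With a nonzero pivot, the matrix is a
    product of a lower shear, a block diagonal matrix with the Schur complement [S] as its second
    block, and an upper shear. *)
Lemma lebesgue_scales_unit (R : realType) n (M : 'M[R]_n) :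
  M \in unitmx -> lebesgue_scales M.
Proof.
elim: n M => [|n IH] M uM.
  move=> f mf f0; rewrite det_mx00 normr1 mul1e.
  by apply: eq_integral => x _; congr f; apply/rowP => -[].
pose B : 'M[R]_(1 + n) := M.
have LDU (a : R) r c (D : 'M[R]_n) : a != 0%R ->
    (block_mx a%:M r c D : 'M[R]_(1 + n)) \in unitmx ->
    lebesgue_scales (block_mx a%:M r c D : 'M[R]_(1 + n)).
  move=> a0 uB.
  pose S := D - (a^-1 *: c) *m r.
  have E : block_mx a%:M r c D = block_mx 1%:M 0 (a^-1 *: c) 1%:M *m
      (block_mx a%:M 0 0 S *m block_mx 1%:M (a^-1 *: r) 0 1%:M) :> 'M[R]_(1 + n).
    rewrite !mulmx_block !(mul0mx, mulmx0, mul1mx, mulmx1, addr0, add0r).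
    rewrite !mul_scalar_mx mul_mx_scalar !scalerA mulfV// !scale1r.
    by rewrite addrC subrK.
  have uS : S \in unitmx.
    move: uB; rewrite E !unitmx_mul => /and3P[_ + _].
    by rewrite !unitmxE det_ublock unitrM => /andP[].
  rewrite E; apply: lebesgue_scalesM; first exact: lebesgue_scales_lower.
  apply: lebesgue_scalesM; last exact: lebesgue_scales_upper.
  exact: lebesgue_scales_diag (IH _ uS).
have BE : B = block_mx (B 0 0)%:M (ursubmx B) (dlsubmx B) (drsubmx B).
  by rewrite -[LHS]submxK [ulsubmx B]mx11_scalar !mxE !lshift0.
have [B00|B00] := eqVneq (B 0 0) 0; last first.
  by rewrite -[M]/B BE; apply: LDU => //; rewrite -BE.
have [i ci0] : exists i, dlsubmx B i 0 != 0.
  apply: contrapT => /forallNP c0.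
  suff : \det B = 0 by move=> detB; move: uM; rewrite unitmxE -[M]/B detB unitr0.
  rewrite BE B00 (_ : dlsubmx B = 0) ?det_ublock ?det_scalar1 ?mul0r//.
  apply/matrixP => i j; rewrite (ord1 j) [RHS]mxE.
  by apply/eqP/negP => ci; apply: (c0 i); apply/negP.
(* Zero pivot: [U 1] adds the lower row [i] to the top row, whose first entry becomes the nonzero
   [dlsubmx B i 0], and [U (-1)] undoes this. A shear thus does the work of a row exchange. *)
pose U s : 'M[R]_(1 + n) := block_mx 1%:M (s *: delta_mx 0 i) 0 1%:M.
have -> : M = U (-1) *m (U 1 *m B).
  rewrite mulmxA mulmx_block !(mul0mx, mulmx0, mul1mx, mulmx1, addr0, add0r).
  by rewrite -scalerDl subrr scale0r -scalar_mx_block mul1mx.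
apply: lebesgue_scalesM; first exact: lebesgue_scales_upper.
have UBE : U 1 *m B = block_mx (dlsubmx B i 0)%:M
    (ursubmx B + row i (drsubmx B)) (dlsubmx B) (drsubmx B) :> 'M[R]_(1 + n).
  rewrite [in LHS]BE mulmx_block !(mul0mx, mulmx0, mul1mx, mulmx1, addr0, add0r).
  rewrite scale1r -!rowE B00 raddf0 add0r; congr block_mx.
  by rewrite [LHS]mx11_scalar !mxE.
rewrite UBE; apply: LDU => //; rewrite -UBE unitmx_mul uM andbT.
by rewrite unitmxE det_ublock !det1 mulr1 unitr1.
Qed.

(** * Integrals of continuous functions over compact sets *)

Section rV_integrals.
Variable R : realType.
Local Notation mu := (lebesgue_rV R).

Lemma compact_measurable_rV n (D : set 'rV[R]_n) : compact D -> measurable D.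
Proof.
move=> cD; apply: closed_measurable_rV; exact: compact_closed.
Qed.

Lemma compact_lebesgue_lty n (D : set 'rV[R]_n) : compact D -> (mu n D < +oo)%E.
Proof.
move=> cD; have [M [_ /(_ (`|M| + 1))]] := compact_bounded cD.
rewrite ltr_pwDr ?ler_norm// => /(_ isT) DM.
have e0 : 0 < `|M| + 2 by rewrite ltr_pwDr.
apply: (@le_lt_trans _ _ (mu n (box 0 (`|M| + 2)))); last first.
  by rewrite lebesgue_box ?ltry// ltW.
apply: le_measure; rewrite ?inE; [exact: compact_measurable_rV|exact: measurable_box|].
move=> x /DM /= xM; rewrite boxE// -ball_normE/= sub0r normrN.
by rewrite (le_lt_trans xM)// ltrD2l ltr1n.
Qed.

Lemma continuous_integrable_rV n (D : set 'rV[R]_n) (g : 'rV[R]_n -> R) :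
  compact D -> continuous g -> (mu n).-integrable D (EFin \o g).
Proof.
move=> cD cg; apply: measurable_bounded_integrable.
- exact: compact_measurable_rV.
- exact: compact_lebesgue_lty.
- exact: measurable_funTS (continuous_measurable_rV cg).
- have /compact_bounded[M [_ mrt]] := continuous_compact
    (continuous_subspaceT cg) cD.
  by exists M; split; rewrite ?num_real// => ? ? ? ?; exact: mrt.
Qed.

Lemma Rintegral_sum d (T : measurableType d) (m : {measure set T -> \bar R})
    (D : set T) (I : Type) (s : seq I) (g : I -> T -> R) : measurable D ->
  (forall i, m.-integrable D (EFin \o g i)) ->
  \int[m]_(x in D) (\sum_(i <- s) g i x) = \sum_(i <- s) \int[m]_(x in D) g i x.
Proof.
move=> mD ig; elim: s => [|i s IH].
  rewrite big_nil; under eq_Rintegral do rewrite big_nil.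
  by rewrite Rintegral_cst// mul0r.
rewrite big_cons -IH -RintegralD//; first by apply: eq_Rintegral => x _; rewrite big_cons.
rewrite (_ : EFin \o _ = fun x => (\sum_(j <- s) (EFin \o g j) x)%E).
  exact: integrable_sum.
by apply/funext => x /=; rewrite sumEFin.
Qed.

Lemma fineM_EFinl (r : R) (x : \bar R) : fine (r%:E * x)%E = r * fine x.
Proof.
have [->|r0] := eqVneq r 0; first by rewrite mul0e mul0r.
case: x => [x| |] //=; first by rewrite mulr_infty; case: sgrP r0;
  rewrite ?mulr0 ?eqxx// ?mul1e ?mulN1e.
by rewrite mulr_infty; case: sgrP r0; rewrite ?mulr0 ?eqxx// ?mul1e ?mulN1e.
Qed.

(** Covers the indeterminate differences too: by convention both are [-oo], which a positive factor
    preserves. Hence the change of variables below asks only for measurability of the integrand. *)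
Lemma gt0_EFinM_B (r : R) (x y : \bar R) : 0 < r ->
  (r%:E * (x - y) = r%:E * x - r%:E * y)%E.
Proof.
move=> r0; have ry : (r%:E * +oo = +oo)%E by rewrite gt0_muley// lte_fin.
have rNy : (r%:E * -oo = -oo)%E by rewrite gt0_muleNy// lte_fin.
have [d|] := boolP (x +? - y)%E; first by rewrite muleBr.
case: x y => [x| |] [y| |] // _; first by rewrite ry (_ : +oo - +oo = -oo)%E// rNy.
by rewrite rNy (_ : -oo - -oo = -oo)%E// rNy.
Qed.

Lemma Rintegral_rV_affine n (M : 'M[R]_n) (c : 'rV[R]_n) (D : set 'rV[R]_n)
    (g : 'rV[R]_n -> R) : M \in unitmx -> measurable D -> measurable_fun D g ->
  \int[mu n]_(x in D) g x =
  `|\det M| * \int[mu n]_(t in [set t | D (c + t *m M)]) g (c + t *m M).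
Proof.
move=> uM mD mg; rewrite /Rintegral -fineM_EFinl; congr fine.
have dM0 : 0 < `|\det M| by rewrite normr_gt0 -unitfE -unitmxE.
rewrite integral_mkcond [in RHS]integral_mkcond.
set f := (X in (\int[_]_x X x)%E).
set h := (X in _ = (_ * \int[_]_x X x)%E).
have -> : h = (fun t => f (c + t *m M)).
  by apply/funext => t; rewrite /h /f !patchE; congr (if _ then _ else _);
  apply/idP/idP; rewrite !inE.
have mf : measurable_fun setT f.
  have mEg : measurable_fun D (EFin \o g) by exact/measurable_EFinP.
  exact: (measurable_restrictT _ mD).1 mEg.
have key k : measurable_fun setT k -> (forall x, (0 <= k x)%E) ->
    (\int[mu n]_x k x = (`|\det M|)%:E * \int[mu n]_x k (c + x *m M)%R)%E.
  move=> mk k0; rewrite (ge0_integral_rV_shift c)// (lebesgue_scales_unit uM)//.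
    by congr (_ * _)%E; apply: eq_integral => x _; rewrite addrC.
  by have := measurable_comp_mulmxD 1%:M c mk; under eq_fun do rewrite mulmx1.
rewrite [in LHS]integralE [in RHS]integralE gt0_EFinM_B//.
have mp := measurable_funepos mf; have mn := measurable_funeneg mf.
rewrite (key _ mp (@funepos_ge0 _ _ _)) (key _ mn (@funeneg_ge0 _ _ _)).
by congr (_ * _ - _ * _)%E; apply: eq_integral => x _; rewrite ?funeposE ?funenegE.
Qed.

(** The function vanishes almost everywhere on [D]. An interior point where it does not vanish would
    have a box around it of positive measure, contained in a null set. Continuity then extends the
    zeros to the closure of the interior. *)
Lemma continuous_ge0_Rintegral_eq0 n (D : set 'rV[R]_n) (g : 'rV[R]_n -> R) :
  compact D -> continuous g -> (forall x, D x -> 0 <= g x) ->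
  \int[mu n]_(x in D) g x = 0 -> forall x, closure D° x -> g x = 0.
Proof.
move=> cD cg g0 ig0.
have mD := compact_measurable_rV cD.
have ig := continuous_integrable_rV cD cg.
have mg := continuous_measurable_rV cg.
have ae0 : ae_eq (mu n) D (EFin \o g) (cst 0%E).
  apply/ae_eq_integral_abs => //; first exact/measurable_EFinP/measurable_funTS.
  have := fineK (integrable_fin_num mD ig); rewrite [fine _]ig0 => E.
  transitivity (\int[mu n]_(x in D) (EFin \o g) x)%E; last by rewrite -E.
  by apply: eq_integral => x /[!inE] Dx /=; rewrite ger0_norm// g0.
have Dg x : D° x -> g x = 0.
  move=> Dx; apply/eqP/negP => /negP gx0.
  have oA : open (D° `&` g @^-1` [set y | y != 0]).
    apply: openI; first exact: open_interior.
    by apply: open_comp => //; exact: open_neq.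
  have : nbhs x (D° `&` g @^-1` [set y | y != 0]) by exact: open_nbhs_nbhs.
  move=> /nbhs_ballP[e /= e0 xe].
  have [N [mN N0 DN]] := ae0.
  suff : (mu n (box x e) <= mu n N)%E.
    rewrite (lebesgue_box _ (ltW e0)) [leRHS](N0 : _ = 0%E) lee_fin leNgt exprn_gt0//.
    by rewrite pmulrn_lgt0.
  apply: le_measure; rewrite ?inE//; first exact: measurable_box.
  rewrite boxE// => y /xe[Dy gy]; apply: DN => /= H.
  by have [/eqP] := H (interior_subset Dy); exact/negP.
have cZ : closed (g @^-1` [set 0]).
  by apply: preimage_closed; [move=> y _; exact: cg|exact: closed_eq].
move=> x Dx; suff : (g @^-1` [set 0]) x by [].
by rewrite ((closure_id _).1 cZ); exact: (closureS (A := D°)) Dx.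
Qed.

End rV_integrals.

(** * Directional derivatives of C1 functions *)

Section directional_derivatives.
Variables (R : realType) (V : normedModType R).
Implicit Types (f : V -> R) (x v w : V).

Lemma is_derive_line f x v (s : R) : derivable f (x + s *: v) v ->
  is_derive s 1 (fun t => f (x + t *: v)) ('D_v f (x + s *: v)).
Proof.
have E : (fun h : R => h^-1 *: (((fun t => f (x + t *: v)) \o shift s) (h *: 1)
    - f (x + s *: v))) =
    (fun h => h^-1 *: ((f \o shift (x + s *: v)) (h *: v) - f (x + s *: v))).
  apply/funext => h /=; congr (_ *: (f _ - _)).
  by rewrite [h *: 1]mulr1 scalerDl addrCA.
by move=> df; split; rewrite /derivable /derive E.
Qed.

Lemma MVT_line f x v (h : R) : (forall y, derivable f y v) ->
  exists2 c, `|c| <= `|h| & f (x + h *: v) - f x = h * 'D_v f (x + c *: v).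
Proof.
move=> df.
have dl (s : R) : is_derive s (1 : R) (fun t => f (x + t *: v)) ('D_v f (x + s *: v)).
  exact: is_derive_line.
have cl : continuous (fun t : R => f (x + t *: v)).
  by move=> s; apply/differentiable_continuous/derivable1_diffP; case: (dl s).
have [h0|h0] := leP 0 h.
  have [c] := MVT_segment h0 (fun s _ => dl s) (continuous_subspaceT cl).
  rewrite in_itv/= => /andP[c0 ch]; rewrite scale0r addr0 subr0 mulrC => E.
  by exists c => //; rewrite !ger0_norm.
have [c] := MVT_segment (ltW h0) (fun s _ => dl s) (continuous_subspaceT cl).
rewrite in_itv/= => /andP[hc c0]; rewrite scale0r addr0 sub0r => E.
exists c; first by rewrite !ler0_norm ?lerN2// ltW.
by rewrite -opprB E mulrN opprK mulrC.
Qed.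

(* The mean value theorem in direction v, at the moving base point x + h w. *)
Lemma is_derive_dirD f x v w : (forall y, derivable f y v) ->
  derivable f x w -> {for x, continuous ('D_v f)} ->
  is_derive x (v + w) f ('D_v f x + 'D_w f x).
Proof.
move=> dv dw cv.
have H : (fun h : R => h^-1 *: (f (x + h *: w + h *: v) - f (x + h *: w)))
    @ 0^' --> 'D_v f x.
  apply/cvgrPdist_lt => e e0.
  have /cvgrPdist_lt/(_ e e0)/nbhs_ballP[d /= d0 dP] := cv.
  near=> h.
  have h0 : h != 0 by near: h; exact: nbhs_dnbhs_neq.
  (* Keeps the intermediate point [x + h *: w + c *: v], where |c| <= |h|, within [d] of [x]; the
     summand 1 makes the denominator positive. *)
  have hd : `|h| < d / (`|w| + `|v| + 1).
    near: h; apply: dnbhs0_lt.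
    by rewrite divr_gt0// ltr_wpDl// addr_ge0.
  have [c ch ->] := MVT_line (x + h *: w) h dv.
  rewrite [_ *: _]mulrA mulVf// mul1r; apply: dP.
  rewrite -ball_normE/= -addrA opprD addrA subrr sub0r normrN.
  apply: le_lt_trans (ler_normD _ _) _; rewrite !normrZ.
  apply: (@le_lt_trans _ _ (`|h| * (`|w| + `|v| + 1))).
    rewrite !mulrDr mulr1 -addrA lerD2l (le_trans (ler_wpM2r _ ch))//.
    by rewrite lerDl.
  by rewrite -ltr_pdivlMr// ltr_wpDl// addr_ge0.
have E : (fun h : R => h^-1 *: (f (x + h *: w + h *: v) - f (x + h *: w))) +
    (fun h => h^-1 *: ((f \o shift x) (h *: w) - f x)) =
    (fun h => h^-1 *: ((f \o shift x) (h *: (v + w)) - f x)).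
  apply/funext => h; rewrite /= fctE -scalerDr addrA (addrC (h *: w)) subrK.
  congr (_ *: (f _ - _)).
  by rewrite scalerDr [RHS]addrC [h *: v + _]addrC addrA.
have {}H : (fun h => h^-1 *: ((f \o shift x) (h *: (v + w)) - f x)) @ 0^' -->
    'D_v f x + 'D_w f x by rewrite -E; exact: cvgD H dw.
by split; [apply/cvg_ex; eexists; exact: H|exact: (cvg_lim (@norm_hausdorff _ _) H)].
Unshelve. all: by end_near. Qed.

Lemma is_derive_dirZ f x v (a : R) : derivable f x v ->
  is_derive x (a *: v) f (a * 'D_v f x).
Proof.
move=> df; have [->|a0] := eqVneq a 0.
  by rewrite scale0r mul0r; exact: is_derive0.
have H : (fun h : R => h^-1 *: ((f \o shift x) (h *: (a *: v)) - f x)) @ 0^' -->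
    a * 'D_v f x.
  have -> : (fun h : R => h^-1 *: ((f \o shift x) (h *: (a *: v)) - f x)) =
      (fun h : R => a * (h * a)^-1 *: ((f \o shift x) ((h * a) *: v) - f x)).
    by apply/funext => h /=; rewrite scalerA invfM (mulrC h^-1) mulrA mulfV// mul1r.
  have /cvgrPdist_lt df' := df.
  apply/cvgrPdist_lt => e e0.
  have /df'/nbhs_ballP[d /= d0 dP] : 0 < e / `|a| by rewrite divr_gt0// normr_gt0.
  apply/nbhs_ballP; exists (d / `|a|); first by rewrite /= divr_gt0// normr_gt0.
  move=> h /=; rewrite -ball_normE/= sub0r normrN => hd h0.
  have := dP (h * a); rewrite -ball_normE/= sub0r normrN normrM -ltr_pdivlMr ?normr_gt0//.
  move=> /(_ hd); rewrite mulf_neq0// => /(_ isT); rewrite -/('D_v f x) => H.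
  rewrite -scalerA -mulrBr normrM mulrC -ltr_pdivlMr ?normr_gt0//.
by split; [apply/cvg_ex; eexists; exact: H|exact: (cvg_lim (@norm_hausdorff _ _) H)].
Qed.

End directional_derivatives.

Lemma continuous_sum (T : topologicalType) (R : realType) (I : Type)
    (r : seq I) (F : I -> T -> R) : (forall i, continuous (F i)) ->
  continuous (fun x => \sum_(i <- r) F i x).
Proof.
move=> cF; elim: r => [|i r IH] x.
  by under eq_fun do rewrite big_nil; exact: cst_continuous.
under eq_fun do rewrite big_cons.
exact: (continuousD (cF i x) (IH x)).
Qed.

Lemma continuous_prod (T : topologicalType) (R : realType) (I : Type)
    (r : seq I) (F : I -> T -> R) : (forall i, continuous (F i)) ->
  continuous (fun x => \prod_(i <- r) F i x).
Proof.
move=> cF; elim: r => [|i r IH] x.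
  by under eq_fun do rewrite big_nil; exact: cst_continuous.
under eq_fun do rewrite big_cons.
exact: (continuousM (cF i x) (IH x)).
Qed.

Section C1.
Variables (R : realType) (d : nat).
Local Notation V := 'rV[R]_d.+1.
Local Notation poly := (mpoly.mpoly d.+1 R).
Implicit Types (G H : V -> R) (x w : V) (p q : poly).

Definition C1 G : Prop :=
  [/\ continuous G, forall i x, derivable G x (delta_mx 0 i)
    & forall i, continuous (partial i G)].

(** The coordinate directions are added one at a time with [is_derive_dirD], which uses continuity
    of the partial derivative in the direction being added. This gives the derivatives along the
    edges of a simplex. *)
Lemma C1_is_derive G w x : C1 G -> is_derive x w G (dot w (grad G x)).
Proof.
move=> [cG dG cdG].
have -> : w = \sum_i w 0 i *: delta_mx 0 i by rewrite {1}[w]row_sum_delta.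
set v := (X in dot X).
have -> : dot v (grad G x) = \sum_i w 0 i * partial i G x.
  by rewrite /v -row_sum_delta; apply: eq_bigr => i _; rewrite [grad _ _ _ _]mxE.
rewrite {}/v; elim: (index_enum _) x => [|i s IH] x.
  by rewrite !big_nil; exact: is_derive0.
have D i' y := is_derive_dirZ (w 0 i') (dG i' y).
have -> : \sum_(j <- i :: s) w 0 j * partial j G x =
    'D_(w 0 i *: delta_mx 0 i) G x + 'D_(\sum_(j <- s) w 0 j *: delta_mx 0 j) G x.
  by rewrite big_cons; congr (_ + _); apply/esym/derive_val.
rewrite big_cons; apply: is_derive_dirD.
- by move=> y; case: (D i y).
- by case: (IH x).
- rewrite (_ : 'D_(_) G = fun y => w 0 i * partial i G y); last first.
    by apply/funext => y; exact: derive_val.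
  by apply: continuousM; [exact: cst_continuous|exact: cdG].
Qed.

Lemma C1_derivable G w x : C1 G -> derivable G x w.
Proof. by move=> /(C1_is_derive w x)[]. Qed.

Lemma C1_derive G w x : C1 G -> 'D_w G x = dot w (grad G x).
Proof. by move=> /(C1_is_derive w x)[]. Qed.

Lemma C1_continuous_derive G w : C1 G -> continuous ('D_w G).
Proof.
move=> C1G; rewrite (_ : 'D_w G = fun x => \sum_i w 0 i * partial i G x).
  have [_ _ cdG] := C1G.
  apply: continuous_sum => i x.
  by apply: continuousM; [exact: cst_continuous|exact: cdG].
apply/funext => x; rewrite C1_derive//.
by apply: eq_bigr => i _; rewrite mxE.
Qed.

Lemma partialM G H i x : C1 G -> C1 H ->
  partial i (fun y => G y * H y) x = G x * partial i H x + H x * partial i G x.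
Proof. by move=> [_ dG _] [_ dH _]; exact: (deriveM (dG i x) (dH i x)). Qed.

Lemma C1M G H : C1 G -> C1 H -> C1 (fun y => G y * H y).
Proof.
move=> C1G C1H; have [cG dG cdG] := C1G; have [cH dH cdH] := C1H; split.
- by move=> x; apply: continuousM; [exact: cG|exact: cH].
- by move=> i x; exact: (derivableM (dG i x) (dH i x)).
- move=> i; rewrite (_ : partial i _ = fun x =>
      G x * partial i H x + H x * partial i G x).
    move=> x; have cGH := continuousM (cG x) (cdH i x).
    exact: (continuousD cGH (continuousM (cH x) (cdG i x))).
  by apply/funext => x; exact: partialM.
Qed.

Lemma smooth_C1 G : smooth G -> C1 G.
Proof.
move=> sG; split; first by case: (sG [::]).
  by move=> i x; case: (sG [::]) => _ D; exact: D.
by move=> i; case: (sG [:: i]).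
Qed.

Lemma peval_is_derive p i x :
  is_derive x (delta_mx 0 i) (peval p) (peval (pderiv i p) x).
Proof.
pose P p := forall x i, is_derive x (delta_mx 0 i) (peval p) (peval (pderiv i p) x).
have P_M q r : P q -> P r -> P (q * r).
  move=> Pq Pr y j.
  have -> : peval (q * r) = (fun z => peval q z * peval r z).
    by apply/funext => z; rewrite /peval mevalM.
  have [dq vq] := Pq y j; have [dr vr] := Pr y j.
  split; first exact: derivableM.
  apply: etrans (deriveM dq dr) _; rewrite vq vr.
  by rewrite /peval /pderiv mderivM mevalD !mevalM [RHS]addrC mulrC; congr (_ + _); rewrite mulrC.
have P_C c : P (mpolyC d.+1 c).
  move=> y j; have -> : peval (mpolyC d.+1 c) = cst c.
    by apply/funext => z; rewrite /peval mevalC.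
  by rewrite /pderiv mderivC /peval meval0; exact: is_derive_cst.
have P_D q r : P q -> P r -> P (q + r).
  move=> Pq Pr y j.
  have -> : peval (q + r) = (fun z => peval q z + peval r z).
    by apply/funext => z; rewrite /peval mevalD.
  have [dq vq] := Pq y j; have [dr vr] := Pr y j.
  split; first exact: derivableD.
  apply: etrans (deriveD dq dr) _; rewrite vq vr.
  by rewrite /peval /pderiv mderivD mevalD.
have P_U j : P (mpolyX R (mnm1 j)).
  move=> y k; have -> : peval (mpolyX R (mnm1 j)) = (fun z => z 0 j).
    by apply/funext => z; rewrite /peval mevalXU.
  have -> : peval (pderiv k (mpolyX R (mnm1 j))) y = (k == j)%:R.
    rewrite /peval /pderiv mderivX mevalZ mnm1E eq_sym.
    have [->|_] := eqVneq k j; last by rewrite mul0r.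
    rewrite mul1r mevalX big1// => l _.
    by rewrite mnmBE subnn expr0.
  have H : (fun h : R => h^-1 *: (((fun z : V => z 0 j) \o shift y) (h *: delta_mx 0 k)
      - y 0 j)) @ 0^' --> ((k == j)%:R : R).
    apply: cvg_near_cst; near=> h.
    have h0 : h != 0 by near: h; exact: nbhs_dnbhs_neq.
    rewrite /= !mxE eqxx /= addrK [_ *: _]mulrA mulVf// mul1r.
    by rewrite eq_sym.
  by split; [apply/cvg_ex; eexists; exact: H|exact: (cvg_lim (@norm_hausdorff _ _) H)].
have P_X m : P (mpolyX R m).
  rewrite mpolyXE_id; elim/big_ind: _ => [| |j _].
  - by rewrite -[1]/(mpolyC d.+1 1); exact: P_C.
  - exact: P_M.
  - elim: (fun_of_multinom m j) => [|k IH].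
      by rewrite expr0 -[1]/(mpolyC d.+1 1); exact: P_C.
    by rewrite exprS; apply: P_M.
move: x i; elim/mpolyind: p => [|c m p _ _ IH].
  by rewrite -(mpolyC0 d.+1); exact: P_C.
apply: P_D => //; rewrite -mul_mpolyC; exact: P_M.
Unshelve. all: by end_near. Qed.

Lemma peval_C1 p : C1 (peval p).
Proof.
have cp q : continuous (peval q).
  have -> : peval q = fun x => \sum_(m <- msupp q)
      mcoeff m q * \prod_i x 0 i ^+ (fun_of_multinom m i).
    by apply/funext => x; rewrite /peval mevalE.
  apply: continuous_sum => m x; apply: continuousM; first exact: cst_continuous.
  apply: continuous_prod => i y.
  apply: (continuous_comp (f := fun z : V => z 0 i)
    (g := fun r : R => r ^+ (fun_of_multinom m i))).
    exact: coord_continuous.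
  exact: exprn_continuous.
split => //; first by move=> i x; case: (peval_is_derive p i x).
move=> i; rewrite (_ : partial i _ = peval (pderiv i p))//.
by apply/funext => x; case: (peval_is_derive p i x).
Qed.

Lemma partial_peval p i x : partial i (peval p) x = peval (pderiv i p) x.
Proof. by case: (peval_is_derive p i x). Qed.

End C1.

(** * Simplexes and the divergence theorem *)

Section barycentric.
Variable R : realType.

Definition sparam n k (p : 'I_k.+1 -> 'rV[R]_n) (t : 'rV[R]_k) : 'rV[R]_n :=
  p ord0 + t *m edges p.

Definition bary k (t : 'rV[R]_k) (i : 'I_k.+1) : R :=
  if unlift ord0 i is Some j then t 0 j else 1 - \sum_j t 0 j.

(** The vertices of the reference simplex: the origin and the basis vectors. For a permutation [s]
    of the vertices, [sparam (refv \o s)] is the affine map of the reference simplex onto itself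
    that permutes its vertices by [s]. *)
Definition refv k (i : 'I_k.+1) : 'rV[R]_k :=
  if unlift ord0 i is Some j then delta_mx 0 j else 0.

Lemma bary0 k (t : 'rV[R]_k) : bary t ord0 = 1 - \sum_j t 0 j.
Proof. by rewrite /bary unlift_none. Qed.

Lemma bary_lift k (t : 'rV[R]_k) j : bary t (lift ord0 j) = t 0 j.
Proof. by rewrite /bary liftK. Qed.

Lemma bary_sum k (t : 'rV[R]_k) : \sum_i bary t i = 1.
Proof.
by rewrite big_ord_recl bary0 (eq_bigr _ (fun j _ => bary_lift t j)) subrK.
Qed.

Lemma ref_simplexP k (t : 'rV[R]_k) : ref_simplex t <-> forall i, 0 <= bary t i.
Proof.
split=> [[t0 t1] i|t0].
  by case: (unliftP ord0 i) => [j ->|->]; rewrite ?bary_lift ?bary0 ?subr_ge0.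
split=> [i|]; first by rewrite -bary_lift.
by rewrite -subr_ge0 -bary0.
Qed.

Lemma sparamE n k (p : 'I_k.+1 -> 'rV[R]_n) t :
  sparam p t = \sum_i bary t i *: p i.
Proof.
rewrite big_ord_recl bary0 scalerBl scale1r /sparam mulmx_sum_row.
rewrite (eq_bigr (fun i => t 0 i *: p (lift ord0 i)) (F1 := fun i => bary t _ *: _)); last first.
  by move=> i _; rewrite bary_lift.
rewrite -addrA; congr (_ + _); rewrite scaler_suml -sumrN -big_split/=.
by apply: eq_bigr => i _; rewrite rowK scalerBr addrC.
Qed.

Lemma sparam_sum n k (p : 'I_k.+1 -> 'rV[R]_n) (l : 'I_k.+1 -> R) :
  \sum_i l i = 1 -> \sum_i l i *: p i = sparam p (\row_i l (lift ord0 i)).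
Proof.
move=> l1; rewrite sparamE; apply: eq_bigr => i _; congr (_ *: _).
case: (unliftP ord0 i) => [j ->|->]; first by rewrite bary_lift mxE.
rewrite bary0 (eq_bigr (fun j => l (lift ord0 j))) => [|j _]; last by rewrite mxE.
by rewrite -l1 big_ord_recl addrK.
Qed.

Lemma simplexP n k (p : 'I_k.+1 -> 'rV[R]_n) x :
  simplex p x <-> exists2 t, ref_simplex t & x = sparam p t.
Proof.
split=> [[l [l0 l1 ->]]|[t /ref_simplexP t0 ->]].
  exists (\row_i l (lift ord0 i)); last exact: sparam_sum.
  split=> [i|]; first by rewrite mxE.
  under eq_bigr do rewrite mxE.
  by rewrite -l1 [leRHS]big_ord_recl lerDr.
by exists (bary t); split=> //; [exact: bary_sum|exact: sparamE].
Qed.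

Lemma simplex_vertex n k (p : 'I_k.+1 -> 'rV[R]_n) i : simplex p (p i).
Proof.
exists (fun j => (j == i)%:R); split=> [j||]; first exact: ler0n.
  by rewrite (bigD1 i)//= eqxx big1 ?addr0// => j /negPf ->.
rewrite (bigD1 i)//= eqxx scale1r big1 ?addr0// => j /negPf ->.
by rewrite scale0r.
Qed.

Lemma edges_refv k : edges (@refv k) = 1%:M.
Proof.
apply/row_matrixP => i; rewrite rowK row1 /refv unlift_none subr0.
by rewrite liftK.
Qed.

Lemma sparam_refv k (t : 'rV[R]_k) : sparam (@refv k) t = t.
Proof. by rewrite /sparam edges_refv mulmx1 /refv unlift_none add0r. Qed.

Lemma sparam_at_refv n k (p : 'I_k.+1 -> 'rV[R]_n) i : sparam p (refv i) = p i.
Proof.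
rewrite /sparam /refv; case: unliftP => [j ->|->]; last by rewrite mul0mx addr0.
by rewrite -rowE rowK addrC subrK.
Qed.

Lemma edges_comp n k (p : 'I_k.+1 -> 'rV[R]_n) m (s : 'I_m.+1 -> 'I_k.+1) :
  edges (p \o s) = edges (@refv k \o s) *m edges p.
Proof.
apply/row_matrixP => i; rewrite row_mul !rowK /= mulmxBl.
rewrite -(sparam_at_refv p (s _)) -(sparam_at_refv p (s ord0)).
by rewrite /sparam opprD addrACA subrr add0r.
Qed.

Lemma sparam_comp n k (p : 'I_k.+1 -> 'rV[R]_n) m (s : 'I_m.+1 -> 'I_k.+1) t :
  sparam (p \o s) t = sparam p (sparam (@refv k \o s) t).
Proof.
rewrite /sparam edges_comp /= -(sparam_at_refv p (s ord0)) /sparam.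
by rewrite mulmxDl mulmxA addrA.
Qed.

(** The determinant is multiplicative along powers of [s], and [s] has finite order, so its absolute
    value is a nonnegative real with some positive power equal to 1. *)
Lemma det_edges_perm k (s : {perm 'I_k.+1}) :
  `|\det (edges (@refv k \o s))| = 1.
Proof.
have H N : \det (edges (@refv k \o (s ^+ N)%g)) =
    \det (edges (@refv k \o s)) ^+ N.
  elim: N => [|N IH].
    rewrite expr0 expg0 (_ : _ \o _ = @refv k) ?edges_refv ?det1//.
    by apply/funext => i /=; rewrite perm1.
  rewrite expgS exprS -IH -det_mulmx; congr (\det _).
  rewrite -(edges_comp (@refv k \o (s ^+ N)%g) s); congr edges.
  by apply/funext => i /=; rewrite permM.
have : `|\det (edges (@refv k \o s))| ^+ #[s]%g = 1.
  rewrite -normrX -H expg_order (_ : _ \o _ = @refv k) ?edges_refv ?det1 ?normr1//.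
  by apply/funext => i /=; rewrite perm1.
have := order_gt0 s; case: #[s]%g => // N _ /eqP.
by rewrite pexpr_eq1// => /eqP.
Qed.

Lemma norm_det_edges_perm k (p : 'I_k.+1 -> 'rV[R]_k) (s : {perm 'I_k.+1}) :
  `|\det (edges (p \o s))| = `|\det (edges p)|.
Proof. by rewrite edges_comp det_mulmx normrM det_edges_perm mul1r. Qed.

Lemma bary_perm k (s : {perm 'I_k.+1}) (t : 'rV[R]_k) i :
  bary (sparam (@refv k \o s) t) (s i) = bary t i.
Proof.
have E j : bary (sparam (@refv k \o s) t) j = bary t (s^-1%g j).
  have -> : sparam (@refv k \o s) t = \sum_j bary t (s^-1%g j) *: @refv k j.
    rewrite sparamE [RHS](reindex_inj (@perm_inj _ s)) /=.
    by apply: eq_bigr => l _; rewrite permK.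
  rewrite sparam_sum; last first.
    rewrite (reindex_inj (@perm_inj _ s)) /= -[RHS](bary_sum t).
    by apply: eq_bigr => l _; rewrite permK.
  rewrite sparam_refv; case: (unliftP ord0 j) => [l ->|->].
    by rewrite bary_lift mxE.
  rewrite bary0 (eq_bigr (fun j => bary t (s^-1%g (lift ord0 j)))) => [|l _]; last first.
    by rewrite mxE.
  apply/eqP; rewrite subr_eq -(bary_sum t).
  rewrite (reindex_inj (@perm_inj _ s^-1)%g) /=.
  by rewrite big_ord_recl.
by rewrite E permK.
Qed.

Lemma ref_simplex_perm k (s : {perm 'I_k.+1}) (t : 'rV[R]_k) :
  ref_simplex (sparam (@refv k \o s) t) <-> ref_simplex t.
Proof.
split=> /ref_simplexP t0; apply/ref_simplexP => i; first by rewrite -(bary_perm s).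
by rewrite -(permKV s i) bary_perm.
Qed.

End barycentric.

Lemma continuous_rVP (T : topologicalType) (R : realType) n (f : T -> 'rV[R]_n) :
  (forall i, continuous (fun x => f x 0 i)) -> continuous f.
Proof.
move=> cf x; apply/cvg_ballP => e e0.
have : \forall y \near x, forall i, ball (f x 0 i) e (f y 0 i).
  by apply: filter_forall => i; move/cvg_ballP : (cf i x); exact.
by apply: filterS => y Hy; split=> // i j; rewrite (ord1 i); exact: Hy.
Qed.

Lemma continuous_mulmxD (R : realType) m n (M : 'M[R]_(m, n)) (c : 'rV[R]_n) :
  continuous (fun x : 'rV[R]_m => c + x *m M).
Proof.
apply: continuous_rVP => i.
rewrite (_ : (fun x => _) = fun x : 'rV[R]_m => c 0 i + \sum_j x 0 j * M j i).
  move=> x; apply: continuousD; first exact: cst_continuous.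
  apply: continuous_sum => j y; apply: continuousM; last exact: cst_continuous.
  exact: coord_continuous.
by apply/funext => x; rewrite !mxE.
Qed.

Section simplex_integrals.
Variable R : realType.
Local Notation mu := (lebesgue_rV R).

Lemma continuous_sparam n k (p : 'I_k.+1 -> 'rV[R]_n) : continuous (sparam p).
Proof. exact: continuous_mulmxD. Qed.

Lemma compact_ref_simplex k : compact (@ref_simplex R k).
Proof.
apply: (@subclosed_compact _ _ 
    [set v : 'rV[R]_k | forall i, v ord0 i \in `[0, 1]]).
- rewrite (_ : @ref_simplex R k = (\bigcap_i [set t : 'rV[R]_k | 0 <= t 0 i]) `&`
      [set t : 'rV[R]_k | \sum_i t 0 i <= 1]); last first.
    by apply/seteqP; split=> t [t0 t1]; split=> // i; [move=> _|]; exact: t0.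
  apply: closedI.
    apply: closed_bigI => i _; apply: (@preimage_closed _ _ (fun t : 'rV[R]_k => t 0 i) [set y | 0 <= y]).
      by move=> t _; exact: coord_continuous.
    exact: closed_ge.
  apply: (@preimage_closed _ _ (fun t : 'rV[R]_k => \sum_i t 0 i) [set y | y <= 1]).
    by move=> t _; apply: continuous_sum => i; exact: coord_continuous.
  exact: closed_le.
- apply: (@rV_compact _ _ (fun=> `[(0 : R), 1]%classic)) => _.
  exact: segment_compact.
- move=> t [t0 t1] i; rewrite /= in_itv/= t0/= (le_trans _ t1)//.
  by rewrite (bigD1 i)//= lerDl sumr_ge0.
Qed.

Lemma compact_simplex n k (p : 'I_k.+1 -> 'rV[R]_n) : compact (simplex p).
Proof.
rewrite (_ : simplex p = sparam p @` @ref_simplex R k).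
  apply: continuous_compact; last exact: compact_ref_simplex.
  exact/continuous_subspaceT/continuous_sparam.
apply/seteqP; split=> x; first by move=> /simplexP[t St ->]; exists t.
by move=> [t St <-]; apply/simplexP; exists t.
Qed.

(* simplex_int without its Gram factor. *)
Definition ref_int n k (p : 'I_k.+1 -> 'rV[R]_n) (g : 'rV[R]_n -> R) : R :=
  \int[mu k]_(t in @ref_simplex R k) g (sparam p t).

Lemma continuous_comp_sparam n k (p : 'I_k.+1 -> 'rV[R]_n) (g : 'rV[R]_n -> R) :
  continuous g -> continuous (g \o sparam p).
Proof.
by move=> cg x; apply: continuous_comp; [exact: continuous_sparam|exact: cg].
Qed.

Lemma integrable_ref_simplex k (g : 'rV[R]_k -> R) : continuous g ->
  (mu k).-integrable (@ref_simplex R k) (EFin \o g).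
Proof. by apply: continuous_integrable_rV; exact: compact_ref_simplex. Qed.

Lemma measurable_ref_simplex k : measurable (@ref_simplex R k).
Proof. by apply: compact_measurable_rV; exact: compact_ref_simplex. Qed.

Lemma eq_ref_int n k (p : 'I_k.+1 -> 'rV[R]_n) (g h : 'rV[R]_n -> R) :
  (forall x, simplex p x -> g x = h x) -> ref_int p g = ref_int p h.
Proof.
move=> gh; apply: eq_Rintegral => t; rewrite inE => St; apply: gh.
by apply/simplexP; exists t.
Qed.

Lemma ref_int_sum n k (p : 'I_k.+1 -> 'rV[R]_n) (I : Type) (s : seq I)
    (g : I -> 'rV[R]_n -> R) : (forall i, continuous (g i)) ->
  ref_int p (fun x => \sum_(i <- s) g i x) = \sum_(i <- s) ref_int p (g i).
Proof.
move=> cg; apply: Rintegral_sum => [|i]; first exact: measurable_ref_simplex.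
by apply: integrable_ref_simplex; exact: continuous_comp_sparam (cg i).
Qed.

Lemma ref_intZr n k (p : 'I_k.+1 -> 'rV[R]_n) (a : R) (g : 'rV[R]_n -> R) :
  continuous g -> ref_int p (fun x => g x * a) = ref_int p g * a.
Proof.
move=> cg; apply: (RintegralZr (f := g \o sparam p)).
  exact: measurable_ref_simplex.
by apply: integrable_ref_simplex; exact: continuous_comp_sparam.
Qed.

(** Relabelling the vertices amounts to an affine map of the reference simplex onto itself with
    determinant 1 or -1. *)
Lemma ref_int_perm n k (p : 'I_k.+1 -> 'rV[R]_n) (s : {perm 'I_k.+1})
  (g : 'rV[R]_n -> R) : continuous g -> ref_int (p \o s) g = ref_int p g.
Proof.
move=> cg; rewrite /ref_int.
have uA : edges (@refv R k \o s) \in unitmx.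
  by rewrite unitmxE unitfE -normr_gt0 det_edges_perm.
have mg : measurable_fun (@ref_simplex R k) (g \o sparam p).
  have cgp := @continuous_comp_sparam _ _ p _ cg.
  exact: measurable_funTS (continuous_measurable_rV cgp).
rewrite [RHS](Rintegral_rV_affine ((@refv R k \o s) ord0) uA
  (@measurable_ref_simplex k) mg) det_edges_perm mul1r.
rewrite (_ : [set t | _] = @ref_simplex R k).
  by apply: eq_Rintegral => t _; rewrite sparam_comp.
by apply/seteqP; split=> t /= /(ref_simplex_perm s).
Qed.

Lemma simplex_int_perm n k (p : 'I_k.+1 -> 'rV[R]_n) (s : {perm 'I_k.+1})
  (g : 'rV[R]_n -> R) : continuous g -> simplex_int (p \o s) g = simplex_int p g.
Proof.
move=> cg; rewrite /simplex_int; congr (Num.sqrt _ * _); last first.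
  exact: ref_int_perm.
rewrite edges_comp trmx_mul !mulmxA -(mulmxA _ (edges p)) !det_mulmx det_tr.
by rewrite mulrAC -expr2 -real_normK ?num_real// det_edges_perm expr1n mul1r.
Qed.

Lemma sparam_inj k (p : 'I_k.+1 -> 'rV[R]_k) : edges p \in unitmx ->
  injective (sparam p).
Proof. by move=> up x y /addrI /(can_inj (mulmxK up)). Qed.

Lemma Rintegral_simplex k (p : 'I_k.+1 -> 'rV[R]_k) (g : 'rV[R]_k -> R) :
  edges p \in unitmx -> continuous g ->
  \int[mu k]_(x in simplex p) g x = `|\det (edges p)| * ref_int p g.
Proof.
move=> up cg.
have mS : measurable (simplex p).
  by apply: compact_measurable_rV; exact: compact_simplex.
rewrite (Rintegral_rV_affine (p ord0) up mS); last first.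
  exact: measurable_funTS (continuous_measurable_rV cg).
congr (_ * _); rewrite (_ : [set t | _] = @ref_simplex R k)//.
apply/seteqP; split=> t /=; last by move=> St; apply/simplexP; exists t.
by move=> /simplexP[u Su] /(sparam_inj up) ->.
Qed.

End simplex_integrals.

(** * Slicing the reference simplex and the fundamental theorem of calculus *)

Section simplex_ftc.
Variable R : realType.
Local Notation mu := (lebesgue_rV R).

Lemma ref_simplex_cons k a (v : 'rV[R]_k) :
  @ref_simplex R k.+1 (row_cons (a, v)) <->
  @ref_simplex R k v /\ a \in `[0, 1 - \sum_i v 0 i].
Proof.
have sE : \sum_i (row_cons (a, v)) 0 i = a + \sum_i v 0 i.
  rewrite big_ord_recl row_cons0; congr (_ + _).
  by apply: eq_bigr => i _; rewrite row_cons_lift.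
rewrite in_itv/= lerBrDr; split=> [[t0 t1]|[[v0 v1] /andP[a0 av]]].
  rewrite sE in t1; have a0 := t0 ord0; rewrite row_cons0 in a0.
  have v0 i : 0 <= v 0 i by rewrite -(row_cons_lift (a, v)).
  rewrite a0 t1; split=> //; split=> //.
  by rewrite (le_trans _ t1)// lerDr.
split; last by rewrite sE.
by move=> i; case: (unliftP ord0 i) => [j ->|->]; rewrite ?row_cons_lift ?row_cons0.
Qed.

(** The head coordinate goes into the inner integral, over a segment whose length depends on the
    tail, so that the fundamental theorem of calculus can be applied there. *)
Lemma Rintegral_ref_simplexS k (h : 'rV[R]_k.+1 -> R) : continuous h ->
  \int[mu k.+1]_(t in @ref_simplex R k.+1) h t =
  \int[mu k]_(v in @ref_simplex R k)
    \int[lebesgue_measure]_(a in `[0, 1 - \sum_i v 0 i]) h (row_cons (a, v)).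
Proof.
move=> ch; pose S := @ref_simplex R k.+1.
have mS : measurable S by exact: measurable_ref_simplex.
have ih := integrable_ref_simplex ch.
pose f := (EFin \o h) \_ S.
have intf : (mu k.+1).-integrable setT f.
  by apply/integrable_restrict => //; rewrite setTI.
have mf : measurable_fun setT f by exact: measurable_int intf.
have mfc : measurable_fun setT (f \o @row_cons R k).
  by apply: measurableT_comp => //; exact: measurable_row_cons.
have intfc : (lebesgue_measure \x mu k)%E.-integrable setT (f \o @row_cons R k).
  apply/integrableP; split=> //.
  have /integrableP[_] := intf.
  rewrite [X in (X < _)%E](ge0_integral_pushforward (@measurable_row_cons R k))//.
  exact: measurableT_comp.
have intE (v : 'rV[R]_k) : (\int[lebesgue_measure]_a f (row_cons (a, v)))%E =
    ((fun v => \int[lebesgue_measure]_(a in `[0%R, (1 - \sum_i v 0 i)%R])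
      (h (row_cons (a, v)))%:E)%E \_ (@ref_simplex R k)) v.
  rewrite patchE; case: ifPn => [/set_mem Sv|/negP nSv].
    rewrite [RHS]integral_mkcond; apply: eq_integral => a _.
    rewrite /f !patchE; congr (if _ then _ else _).
    apply/idP/idP => [/set_mem/ref_simplex_cons[_ ?]|]; first exact: mem_set.
    by move=> /set_mem av; apply/mem_set/ref_simplex_cons.
  rewrite integral0_eq// => a _; rewrite /f patchE; case: ifPn => // /set_mem.
  by move=> /ref_simplex_cons[Sv _]; exfalso; apply: nSv; exact: mem_set.
rewrite /Rintegral; congr fine.
rewrite integral_mkcond -/f.
rewrite [LHS](integral_pushforward (@measurable_row_cons R k) mf)//.
rewrite preimage_setT -integral21_prod_meas1//.
apply: etrans (eq_integral _ _ (fun v _ => intE v)) _.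
rewrite -integral_mkcond; apply: eq_integral => v _.
rewrite fineK//; apply: integrable_fin_num => //.
apply: continuous_compact_integrable; first exact: segment_compact.
apply: continuous_subspaceT => a.
apply: (continuous_comp (f := fun a : R => row_cons (a, v))); last exact: ch.
apply: continuous_rVP => i; case: (unliftP ord0 i) => [j ->|->].
  by under eq_fun do rewrite row_cons_lift; exact: cst_continuous.
by under eq_fun do rewrite row_cons0.
Qed.

Lemma Rintegral_derive_line (V : normedModType R) (G : V -> R) (x w : V) (b : R) :
  (forall y, derivable G y w) -> continuous ('D_w G) -> 0 <= b ->
  \int[lebesgue_measure]_(a in `[0, b]) 'D_w G (x + a *: w) = G (x + b *: w) - G x.
Proof.
move=> dG cdG; rewrite le_eqVlt => /predU1P[<-|b0].
  by rewrite set_itv1 Rintegral_set1 scale0r addr0 subrr.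
have dl (s : R) : is_derive s (1 : R) (fun t => G (x + t *: w)) ('D_w G (x + s *: w)).
  exact: is_derive_line.
have cl : continuous (fun t : R => G (x + t *: w)).
  by move=> s; apply/differentiable_continuous/derivable1_diffP; case: (dl s).
rewrite /Rintegral (@continuous_FTC2 _ _ (fun t : R => G (x + t *: w)))//=.
- by rewrite scale0r addr0.
- apply: continuous_subspaceT => s.
  apply: (@continuous_comp _ _ _ (fun a : R => x + a *: w) ('D_w G)); last exact: cdG.
  apply: continuousD; first exact: cst_continuous.
  exact: scalel_continuous.
- split=> [s _||]; first by case: (dl s).
    by apply: cvg_at_right_filter; exact: cl.
  by apply: cvg_at_left_filter; exact: cl.
- by move=> s _; rewrite derive1E; exact: derive_val.
Qed.

(** A line parallel to the edge from [p ord0] to [p one] enters the simplex through the face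
    opposite [p one] ([E] at a = 0) and leaves it through the face opposite [p ord0] ([E0]). Both
    faces are parametrized by the same tail [v], so the two end values integrate to the two face
    integrals without any Jacobian. *)
Lemma ref_int_derive n k (p : 'I_k.+2 -> 'rV[R]_n.+1) (G : 'rV[R]_n.+1 -> R) :
  C1 G ->
  let one := lift ord0 ord0 : 'I_k.+2 in
  ref_int p ('D_(p one - p ord0) G) =
  ref_int (p \o lift ord0) G - ref_int (p \o lift one) G.
Proof.
move=> C1G one; set w := p one - p ord0.
have [cG _ _] := C1G.
have lift1 (i : 'I_k) : lift one (lift ord0 i) = lift ord0 (lift ord0 i).
  exact/val_inj.
have lift10 : lift one (ord0 : 'I_k.+1) = ord0 by exact/val_inj.
have E a v : sparam p (row_cons (a, v)) = sparam (p \o lift one) v + a *: w.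
  rewrite !sparamE !big_ord_recl !bary0 !bary_lift row_cons0 /= lift10.
  have -> : \sum_j row_cons (a, v) 0 j = a + \sum_j v 0 j.
    rewrite big_ord_recl row_cons0; congr (_ + _).
    by apply: eq_bigr => i _; rewrite row_cons_lift.
  rewrite (eq_bigr (fun i => v 0 i *: p (lift ord0 (lift ord0 i)))); last first.
    by move=> i _; rewrite bary_lift row_cons_lift.
  rewrite [in RHS](eq_bigr (fun i => v 0 i *: p (lift ord0 (lift ord0 i)))); last first.
    by move=> i _; rewrite bary_lift lift1.
  rewrite [RHS]addrAC addrA; congr (_ + _).
  rewrite (_ : 1 - (a + _) = 1 - \sum_j v 0 j - a); last by ring.
  by rewrite [in LHS]scalerBl /w scalerBr -addrA (addrC (- _)).
have E0 v : sparam (p \o lift one) v + (1 - \sum_i v 0 i) *: w = sparam (p \o lift ord0) v.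
  rewrite !sparamE !big_ord_recl !bary0 /= lift10.
  rewrite [in LHS](eq_bigr (fun i => v 0 i *: p (lift ord0 (lift ord0 i)))); last first.
    by move=> i _; rewrite bary_lift lift1.
  rewrite [in RHS](eq_bigr (fun i => v 0 i *: p (lift ord0 (lift ord0 i)))); last first.
    by move=> i _; rewrite bary_lift.
  by rewrite addrAC -scalerDr /w [p ord0 + _]addrC subrK.
rewrite {1}/ref_int Rintegral_ref_simplexS; last first.
  exact: (continuous_comp_sparam (p := p) (@C1_continuous_derive _ _ G w C1G)).
rewrite /ref_int -RintegralB; first last.
- exact: integrable_ref_simplex (continuous_comp_sparam (p := p \o lift one) cG).
- exact: integrable_ref_simplex (continuous_comp_sparam (p := p \o lift ord0) cG).
- exact: measurable_ref_simplex.
apply: eq_Rintegral => v /set_mem[v0 v1].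
rewrite -E0 -Rintegral_derive_line.
- by apply: eq_Rintegral => a _; rewrite E.
- by move=> y; exact: C1_derivable.
- exact: C1_continuous_derive.
- by rewrite subr_ge0.
Qed.

End simplex_ftc.

Lemma continuous_mulr (T : topologicalType) (R : realType) (f g : T -> R) :
  continuous f -> continuous g -> continuous (fun x => f x * g x).
Proof. by move=> cf cg x; exact: (continuousM (cf x) (cg x)). Qed.

Section dot_lemmas.
Variables (R : realType) (n : nat).
Implicit Types x y z : 'rV[R]_n.

Lemma dotE x y : dot x y = (x *m y^T) 0 0.
Proof. by rewrite mxE; apply: eq_bigr => i _; rewrite mxE. Qed.

Lemma dotC x y : dot x y = dot y x.
Proof. by apply: eq_bigr => i _; rewrite mulrC. Qed.

Lemma dotDl x y z : dot (x + y) z = dot x z + dot y z.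
Proof. by rewrite !dotE mulmxDl mxE. Qed.

Lemma dotZl (a : R) x y : dot (a *: x) y = a * dot x y.
Proof. by rewrite !dotE -scalemxAl mxE. Qed.

Lemma dotNl x y : dot (- x) y = - dot x y.
Proof. by rewrite !dotE mulNmx mxE. Qed.

Lemma dot_suml (I : Type) (s : seq I) (F : I -> 'rV[R]_n) y :
  dot (\sum_(i <- s) F i) y = \sum_(i <- s) dot (F i) y.
Proof. by rewrite dotE mulmx_suml summxE; under eq_bigr do rewrite -dotE. Qed.

Lemma dotDr x y z : dot x (y + z) = dot x y + dot x z.
Proof. by rewrite !(dotC x) dotDl. Qed.

Lemma dotNr x y : dot x (- y) = - dot x y.
Proof. by rewrite !(dotC x) dotNl. Qed.

Lemma dotZr (a : R) x y : dot x (a *: y) = a * dot x y.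
Proof. by rewrite !(dotC x) dotZl. Qed.

Lemma dot_ge0 x : 0 <= dot x x.
Proof. by apply: sumr_ge0 => i _; rewrite -expr2 sqr_ge0. Qed.

Lemma dot_eq0 x : dot x x = 0 -> x = 0.
Proof.
move=> /eqP; rewrite psumr_eq0 => [/allP x0|i _]; last by rewrite -expr2 sqr_ge0.
apply/rowP => i; rewrite mxE; apply/eqP.
by have := x0 i (mem_index_enum i); rewrite /= -expr2 sqrf_eq0.
Qed.

End dot_lemmas.

(** * Outward normals, face areas and the divergence theorem on a simplex *)

Section gauss.
Variable R : realType.
Local Notation mu := (lebesgue_rV R).

Lemma simplex_intE n k (q : 'I_k.+1 -> 'rV[R]_n) (g : 'rV[R]_n -> R) :
  simplex_int q g = Num.sqrt (\det (edges q *m (edges q)^T)) * ref_int q g.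
Proof. by []. Qed.

(** A relabelling of the simplex carries the face opposite [i] to the face opposite [s i]; [t] is
    the relabelling that it induces on the vertices of these faces. *)
Lemma perm_lift k (s : {perm 'I_k.+2}) i : exists t : {perm 'I_k.+1},
  forall l, s (lift i l) = lift (s i) (t l).
Proof.
have f_ex l : exists l', s (lift i l) = lift (s i) l'.
  have : s i != s (lift i l) by rewrite (inj_eq perm_inj) neq_lift.
  by case/unlift_some => l' E _; exists l'.
have [f fE] := choice f_ex.
have f_inj : injective f.
  by move=> x y xy; apply/(@lift_inj _ i)/(@perm_inj _ s); rewrite !fE xy.
by exists (perm f_inj) => l; rewrite permE.
Qed.

Lemma ref_int_derive_edge n k (p : 'I_k.+2 -> 'rV[R]_n.+1) (G : 'rV[R]_n.+1 -> R) a b :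
  C1 G -> a != b ->
  ref_int p ('D_(p a - p b) G) = ref_int (p \o lift b) G - ref_int (p \o lift a) G.
Proof.
move=> C1G ab; have [cG _ _] := C1G.
pose one : 'I_k.+2 := lift ord0 ord0.
(* [s] must send [ord0] to [b] and [one] to [a]. The first transposition settles [ord0] and moves
   [one] to [c]; as [b] differs from both [c] and [a], the second one can send [c] to [a] without
   moving [b]. *)
pose c := tperm ord0 b one.
have cb : c != b.
  by rewrite -[X in _ != X](tpermL ord0 b) (inj_eq perm_inj) eq_sym neq_lift.
pose s := (tperm ord0 b * tperm c a)%g.
have s0 : s ord0 = b by rewrite permM tpermL tpermD.
have s1 : s one = a by rewrite permM -/c tpermL.
rewrite -(ref_int_perm p s); last exact: (@C1_continuous_derive _ _ _ _ C1G).
have := @ref_int_derive R n k (p \o s) G C1G; rewrite -/one /= s0 s1 => ->.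
have [t0 t0E] := perm_lift s ord0; have [t1 t1E] := perm_lift s one.
have -> : (p \o s) \o lift ord0 = (p \o lift b) \o t0.
  by apply/funext => l /=; rewrite t0E s0.
have -> : (p \o s) \o lift one = (p \o lift a) \o t1.
  by apply/funext => l /=; rewrite t1E s1.
by rewrite !ref_int_perm.
Qed.

Variable d : nat.
Local Notation V := 'rV[R]_d.+1.
Variable p : 'I_d.+2 -> V.
Hypothesis up : edges p \in unitmx.

Definition outward (j : 'I_d.+2) (nu : V) : Prop :=
  [/\ enorm nu = 1,
    forall x y, simplex (p \o lift j) x -> simplex (p \o lift j) y -> dot nu (x - y) = 0
  & forall x, simplex (p \o lift j) x -> dot nu (p j - x) < 0].

(** [w j] leads from the base vertex of the face opposite [p j] to [p j], and [F j] holds the edges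
    of that face. The rows of [Q j] are thus edges of the simplex out of one vertex of the face. *)
Let w j : V := p j - p (lift j ord0).
Let F j := edges (p \o lift j).
Let Q j : 'M[R]_(1 + d) := col_mx (w j) (F j).

(** [Q j] is the edge matrix for the relabelling [s] that puts the base vertex of the face first and
    [p j] second. *)
Let normQ j : `|\det (Q j)| = `|\det (edges p)|.
Proof.
pose one : 'I_d.+2 := lift ord0 ord0.
pose s := (tperm ord0 one * lift_perm ord0 j 1)%g.
rewrite -(norm_det_edges_perm p s); congr (`|\det _|).
have s0 : s ord0 = lift j ord0 by rewrite permM tpermL lift_perm_lift perm1.
apply/row_matrixP => i; rewrite [RHS]rowK /= s0.
case: (@splitP 1 d i) => [i0 ii0|i1 ii1].
  have -> : i = lshift d i0 by exact/val_inj.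
  rewrite rowKu (ord1 i0) (_ : lift _ _ = one); last exact/val_inj.
  by rewrite permM tpermR lift_perm_id; apply/rowP => l; rewrite mxE.
have -> : i = rshift 1 i1 by exact/val_inj.
rewrite rowKd rowK /= (_ : lift ord0 (rshift 1 i1) = lift ord0 (lift ord0 i1)); last exact/val_inj.
by rewrite permM tpermD ?lift_perm_lift ?perm1.
Qed.

Let uQ j : Q j \in unitmx.
Proof. by rewrite unitmxE unitfE -normr_gt0 normQ normr_gt0 -unitfE -unitmxE. Qed.

Lemma row_free_face j : row_free (edges (p \o lift j)).
Proof.
apply: inj_row_free => v vF; have : row_mx 0 v *m Q j = 0.
  by rewrite mul_row_col mul0mx add0r.
move/(canRL (mulmxK (uQ j))); rewrite mul0mx -[0 in RHS]row_mx0.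
by move/eq_row_mx => [].
Qed.

(** The first column [y] of the inverse of [Q j] is orthogonal to the edges of the face and pairs to
    1 with [w j]. It therefore points towards [p j], whence the minus sign in the normalized
    vector. *)
Lemma outward_exists j : exists nu, outward j nu.
Proof.
pose y : 'cV[R]_(1 + d) := invmx (Q j) *m delta_mx 0 0.
have Qy : Q j *m y = delta_mx 0 0 by rewrite mulKVmx.
have wy : w j *m y = 1%:M.
  have := congr1 usubmx Qy; rewrite mul_col_mx col_mxKu => ->.
  by apply/matrixP => a b; rewrite !mxE !ord1.
have Fy : F j *m y = 0.
  have := congr1 dsubmx Qy; rewrite mul_col_mx col_mxKd => ->.
  by apply/matrixP => a b; rewrite !mxE.
have y0 : y^T != 0.
  apply/negP => /eqP y0; have : w j *m y = 0 by rewrite -[y]trmxK y0 trmx0 mulmx0.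
  by rewrite wy => /matrixP/(_ 0 0)/eqP; rewrite !mxE oner_eq0.
pose N := enorm (y^T : V).
have N0 : 0 < N.
  rewrite sqrtr_gt0 lt_neqAle dot_ge0 andbT eq_sym.
  by apply: contra y0 => /eqP/dot_eq0 ->.
have dw (x : V) : dot (- N^-1 *: y^T : V) x = - N^-1 * (x *m y) 0 0.
  by rewrite dotZl dotC dotE trmxK.
have pj x : simplex (p \o lift j) x -> exists t, x = p (lift j ord0) + t *m F j.
  by move=> /simplexP[t _ ->]; exists t.
exists (- N^-1 *: y^T : V); split.
- rewrite /enorm dotZl dotZr mulrA mulrNN -expr2.
  have -> : dot (y^T : V) y^T = N ^+ 2 by rewrite sqr_sqrtr ?dot_ge0.
  by rewrite -exprMn mulVf ?gt_eqF// expr1n sqrtr1.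
- move=> x x' /pj[t ->] /pj[t' ->]; rewrite dw opprD addrACA subrr add0r.
  by rewrite -mulmxBl -mulmxA Fy mulmx0 mxE mulr0.
- move=> x /pj[t ->]; rewrite dw opprD addrA mulmxBl -mulmxA Fy mulmx0 subr0.
  by rewrite [_ *m y]wy mxE eqxx mulr1 oppr_lt0 invr_gt0.
Qed.

Lemma outward_vertices j nu l l' : outward j nu -> l != j -> l' != j ->
  dot nu (p l - p l') = 0.
Proof.
move=> [_ nuF _]; rewrite eq_sym => /unlift_some[a -> _].
rewrite eq_sym => /unlift_some[b -> _].
by apply: nuF; [exact: (simplex_vertex (p \o lift j) a)
  |exact: (simplex_vertex (p \o lift j) b)].
Qed.

(* Height times base: the Gram factor of the face is |det (nu; F)|, and
   (w; F) (nu; F)^T is block triangular. *)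
Lemma face_gram_height j nu l : outward j nu -> l != j ->
  Num.sqrt (\det (edges (p \o lift j) *m (edges (p \o lift j))^T)) *
    dot nu (p l - p j) = `|\det (edges p)|.
Proof.
move=> nuP lj; have [nu1 nuF nuw] := nuP; rewrite -/(F j).
have -> : dot nu (p l - p j) = - dot nu (w j).
  rewrite -[p l](subrK (p (lift j ord0))) -addrA dotDr (outward_vertices nuP lj).
    by rewrite add0r -dotNr opprB.
  by rewrite eq_sym neq_lift.
have w0 : dot nu (w j) < 0.
  by apply: nuw; exact: (simplex_vertex (p \o lift j) ord0).
pose N : 'M[R]_(1 + d) := col_mx nu (F j).
have Fnu : F j *m nu^T = 0.
  apply/matrixP => i b; rewrite (ord1 b) [RHS]mxE.
  have -> : (F j *m nu^T) i 0 = dot nu (row i (F j)).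
    by rewrite dotC dotE -row_mul [RHS]mxE.
  rewrite rowK; apply: nuF; exact: (simplex_vertex (p \o lift j)).
(* Used twice: [v = nu] identifies the Gram determinant with the square of [\det N], and [v = w j]
   brings in the height. *)
have detB (v : V) : \det ((col_mx v (F j) : 'M[R]_(1 + d)) *m N^T) =
    dot nu v * \det (F j *m (F j)^T).
  rewrite /N tr_col_mx mul_col_row Fnu det_ublock; congr (_ * _).
  by rewrite [v *m _]mx11_scalar det_scalar1 -dotE dotC.
have detN2 : \det N ^+ 2 = \det (F j *m (F j)^T).
  rewrite expr2 -{2}det_tr -det_mulmx detB.
  suff -> : dot nu nu = 1 by rewrite mul1r.
  by rewrite -[LHS]sqr_sqrtr ?dot_ge0// -/(enorm nu) nu1 expr1n.
have detQN : \det (Q j) * \det N = dot nu (w j) * \det N ^+ 2.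
  by rewrite -[X in _ * X = _]det_tr -det_mulmx detB detN2.
(* Needed to cancel one factor [\det N] at the end. If it vanished, the Gram matrix of the face
   would be singular, against the independence of the face edges. *)
have N0 : \det N != 0.
  apply/negP => /eqP N0; have /eqP := detN2; rewrite N0 expr0n /= eq_sym.
  move=> /det0P[v v0 vFF]; move/negP: v0; apply; apply/eqP.
  have vF : v *m F j = 0.
    by apply: dot_eq0; rewrite dotE trmx_mul mulmxA -(mulmxA v) vFF mul0mx mxE.
  by apply: (row_free_inj (row_free_face j)); rewrite [RHS]mul0mx.
rewrite -detN2 sqrtr_sqr -(normQ j) mulrC -(ltr0_norm w0) -normrM; congr `|_|.
by apply: (mulIf N0); rewrite detQN expr2 mulrA.
Qed.

(** Expand [c] in the edges out of [p ord0]. An edge is tangent to every face except the two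
    opposite its endpoints, and on these [face_gram_height] gives the weights [D] and [- D],
    matching the two face integrals in [ref_int_derive_edge]. *)
Lemma gauss_simplex (G : V -> R) (c : V) (nu : 'I_d.+2 -> V) :
  C1 G -> (forall j, outward j (nu j)) ->
  \int[mu d.+1]_(x in simplex p) 'D_c G x =
  \sum_j simplex_int (p \o lift j) (fun x => G x * dot c (nu j)).
Proof.
move=> C1G nuP; have [cG _ _] := C1G.
rewrite Rintegral_simplex//; last exact: (@C1_continuous_derive _ _ _ _ C1G).
set D := `|_|.
pose g := c *m invmx (edges p).
have cE : c = \sum_i g 0 i *: (p (lift ord0 i) - p ord0).
  by rewrite -[LHS](mulmxKV up) mulmx_sum_row; apply: eq_bigr => i _; rewrite rowK.
pose J j := ref_int (p \o lift j) G.
have -> : ref_int p ('D_c G) = \sum_i g 0 i * (J ord0 - J (lift ord0 i)).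
  rewrite (_ : 'D_c G = fun x => \sum_i 'D_(p (lift ord0 i) - p ord0) G x * g 0 i).
    rewrite ref_int_sum; last first.
      move=> i; apply: continuous_mulr; last exact: cst_continuous.
      exact: (@C1_continuous_derive _ _ _ _ C1G).
    apply: eq_bigr => i _; rewrite ref_intZr; last exact: (@C1_continuous_derive _ _ _ _ C1G).
    by rewrite mulrC ref_int_derive_edge// eq_sym neq_lift.
  apply/funext => x; rewrite C1_derive// {1}cE dot_suml.
  by apply: eq_bigr => i _; rewrite dotZl mulrC C1_derive.
have intE j : simplex_int (p \o lift j) (fun x => G x * dot c (nu j)) =
    \sum_i g 0 i * (Num.sqrt (\det (edges (p \o lift j) *m (edges (p \o lift j))^T)) *
      dot (nu j) (p (lift ord0 i) - p ord0)) * J j.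
  rewrite simplex_intE ref_intZr// -/(J j) cE dot_suml.
  rewrite mulr_sumr mulr_sumr; apply: eq_bigr => i _; rewrite dotZl dotC.
  by ring.
under [RHS]eq_bigr do rewrite intE.
rewrite exchange_big /= mulr_sumr; apply: eq_bigr => i _.
rewrite (bigD1 ord0)//= (bigD1 (lift ord0 i))//=.
rewrite (face_gram_height (nuP ord0)); last by rewrite eq_sym neq_lift.
rewrite -[p (lift ord0 i) - p ord0]opprB dotNr mulrN.
rewrite (face_gram_height (nuP _)) ?neq_lift//.
rewrite big1 => [|j /andP[j0 ji]].
  by rewrite addr0 -/D; ring.
by rewrite dotNr (outward_vertices (nuP j)) ?(eq_sym _ j)// oppr0 !mulr0 mul0r.
Qed.

End gauss.

(** * Geometry of simplexes and of the domain *)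

Section simplex_geometry.
Variable R : realType.
Local Notation mu := (lebesgue_rV R).

Lemma lebesgue_rV_affine n (M : 'M[R]_n) (c : 'rV[R]_n) (A : set 'rV[R]_n) :
  M \in unitmx -> measurable A ->
  mu n A = (`|\det M|%:E * mu n [set t | A (c + t *m M)%R])%E.
Proof.
move=> uM mA.
have mAc : measurable [set x | A (c + x)].
  have := measurable_mulmxD 1%:M c measurableT mA; rewrite setTI.
  by congr measurable; apply/seteqP; split=> x /=; rewrite mulmx1 addrC.
have mAM : measurable [set t | A (c + t *m M)].
  have := measurable_mulmxD M c measurableT mA; rewrite setTI.
  by congr measurable; apply/seteqP; split=> x /=; rewrite addrC.
have indE B : measurable B -> mu n B = (\int[mu n]_x (\1_B x)%:E)%E.
  by move=> mB; rewrite integral_indic// setIT.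
have mE B : measurable B -> measurable_fun setT (fun x : 'rV[R]_n => (\1_B x)%:E).
  by move=> mB; apply/measurable_EFinP; exact: measurable_indic.
rewrite indE// (ge0_integral_rV_shift c); last 2 first.
- exact: mE.
- by move=> x; rewrite lee_fin.
rewrite [in RHS]indE//.
rewrite (_ : (\int[mu n]_x (\1_A (x + c))%:E =
    \int[mu n]_x (\1_[set x | A (c + x)] x)%:E)%E); last first.
  by apply: eq_integral => x _; rewrite !indicE; congr ((_ : bool)%:R%:E);
    apply/idP/idP; rewrite !inE /= addrC.
by apply: lebesgue_scales_unit => //; exact: mE.
Qed.

Lemma affine_independent n k (p : 'I_k.+1 -> 'rV[R]_n) (l l' : 'I_k.+1 -> R) :
  row_free (edges p) -> \sum_i l i = 1 -> \sum_i l' i = 1 ->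
  \sum_i l i *: p i = \sum_i l' i *: p i -> l =1 l'.
Proof.
move=> fp l1 l'1; rewrite !sparam_sum// => /addrI/(row_free_inj fp)/rowP E.
have El i : l (lift ord0 i) = l' (lift ord0 i) by have := E i; rewrite !mxE.
move=> i; case: (unliftP ord0 i) => [j ->//|->].
move: l1; rewrite -l'1 !big_ord_recl => /eqP.
by rewrite (eq_bigr _ (fun i _ => El i)) (inj_eq (addIr _)) => /eqP.
Qed.

(* The transition matrices between the two vertex sets are stochastic and
   their product is the identity, so each row has a single nonzero entry. *)
Lemma simplex_inj n k (p q : 'I_k.+1 -> 'rV[R]_n) :
  row_free (edges p) -> simplex p = simplex q ->
  exists s : {perm 'I_k.+1}, p = q \o s.
Proof.
move=> fp pq.
have /choice[a aP] : forall i, exists a : 'I_k.+1 -> R,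
    [/\ forall j, 0 <= a j, \sum_j a j = 1 & p i = \sum_j a j *: q j].
  by move=> i; have := simplex_vertex p i; rewrite pq.
have /choice[b bP] : forall j, exists b : 'I_k.+1 -> R,
    [/\ forall l, 0 <= b l, \sum_l b l = 1 & q j = \sum_l b l *: p l].
  by move=> j; have := simplex_vertex q j; rewrite -pq.
have abE i l : \sum_j a i j * b j l = (l == i)%:R.
  have [a0 a1 pE] := aP i.
  apply: (affine_independent (l := fun l => \sum_j a i j * b j l)
    (l' := fun l => (l == i)%:R) fp).
  - rewrite exchange_big /= -[RHS]a1; apply: eq_bigr => j _.
    by have [_ b1 _] := bP j; rewrite -mulr_sumr b1 mulr1.
  - by rewrite (bigD1 i)//= eqxx big1 ?addr0// => j /negPf ->.
  - rewrite [RHS](bigD1 i)//= eqxx scale1r [in RHS]big1 ?addr0; last first.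
      by move=> j /negPf ->; rewrite scale0r.
    rewrite [in RHS]pE; under eq_bigr do rewrite scaler_suml.
    rewrite exchange_big /=; apply: eq_bigr => j _; have [_ _ ->] := bP j.
    by rewrite scaler_sumr; apply: eq_bigr => l' _; rewrite scalerA.
have /choice[s sP] : forall i, exists j, p i = q j.
  move=> i; have [a0 a1 _] := aP i.
  have [j aij] : exists j, 0 < a i j.
    apply: contrapT => /forallNP na; have := a1.
    rewrite big1 => [/eqP|j _]; first by rewrite eq_sym oner_eq0.
    by apply/eqP; rewrite eq_le a0 andbT leNgt; apply/negP.
  have [b0 b1 qE] := bP j; exists j.
  (* [abE i l] is then a vanishing sum of nonnegative products, and the factor [a i j] is positive.
     So all the weight of [q j] sits on [p i]. *)
  have bjl l : l != i -> b j l = 0.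
    move=> li; have /eqP := abE i l; rewrite (negPf li) psumr_eq0 => [/allP ab0|j' _].
      have := ab0 j (mem_index_enum j); rewrite /= mulf_eq0 gt_eqF//= => /eqP.
      exact.
    by apply: mulr_ge0 => //; have [] := bP j'.
  have bji : b j i = 1 by rewrite -b1 (bigD1 i)//= big1 ?addr0.
  by rewrite qE (bigD1 i)//= bji scale1r big1 ?addr0// => l /bjl ->; rewrite scale0r.
have s_inj : injective s.
  move=> i i' ss; have pp : p i = p i' by rewrite !sP ss.
  have E (x : 'I_k.+1) : \sum_j (j == x)%:R *: p j = p x.
    rewrite (bigD1 x)//= eqxx scale1r big1 ?addr0// => j /negPf ->.
    by rewrite scale0r.
  have E1 (x : 'I_k.+1) : \sum_j (j == x)%:R = 1 :> R.
    by rewrite (bigD1 x)//= eqxx big1 ?addr0// => j /negPf ->.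
  have := affine_independent fp (E1 i) (E1 i'); rewrite !E pp => /(_ erefl i)/eqP.
  rewrite eqxx; have [//|_] := eqVneq i i'; by rewrite oner_eq0.
by exists (perm s_inj); apply/funext => i /=; rewrite permE.
Qed.

(** Lets two elements that have the same set as a face agree on its surface integral, whatever
    vertex order each of them uses. *)
Lemma simplex_int_set n k (p q : 'I_k.+1 -> 'rV[R]_n) (g : 'rV[R]_n -> R) :
  row_free (edges p) -> simplex p = simplex q -> continuous g ->
  simplex_int p g = simplex_int q g.
Proof.
by move=> fp /(simplex_inj fp)[s ->] cg; rewrite simplex_int_perm.
Qed.

Definition centroid n k (p : 'I_k.+1 -> 'rV[R]_n) : 'rV[R]_n :=
  \sum_i k.+1%:R^-1 *: p i.

(** Every barycentric coordinate of the contracted point is at least e / (k + 1), and the points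
    with all barycentric coordinates positive form an open subset of the simplex. *)
Lemma simplex_contract k (p : 'I_k.+1 -> 'rV[R]_k) x (e : R) :
  edges p \in unitmx -> simplex p x -> 0 < e <= 1 ->
  (simplex p)° (e *: centroid p + (1 - e) *: x).
Proof.
move=> up [l [l0 l1 xE]] /andP[e0 e1].
pose lam j (y : 'rV[R]_k) := bary ((y - p ord0) *m invmx (edges p)) j.
have lamK y : sparam p ((y - p ord0) *m invmx (edges p)) = y.
  by rewrite /sparam mulmxKV// addrC subrK.
have clam j : continuous (lam j).
  have cy : continuous (fun y : 'rV[R]_k => (y - p ord0) *m invmx (edges p)).
    rewrite (_ : (fun y => _) = fun y => - p ord0 *m invmx (edges p) + y *m invmx (edges p)).
      exact: continuous_mulmxD.
    by apply/funext => y; rewrite mulmxDl addrC.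
  have ct j' : continuous (fun t : 'rV[R]_k => t 0 j') by exact: coord_continuous.
  move=> y; apply: (@continuous_comp _ _ _ (fun y : 'rV[R]_k => (y - p ord0) *m invmx (edges p))
    (fun t : 'rV[R]_k => bary t j)); first exact: cy.
  case: (unliftP ord0 j) => [j' ->|->].
    by rewrite (_ : (fun t => bary t _) = fun t : 'rV[R]_k => t 0 j');
      [exact: ct|apply/funext => t; rewrite bary_lift].
  rewrite (_ : (fun t => bary t _) = fun t : 'rV[R]_k => 1 - \sum_i t 0 i).
    by apply: continuousB; [exact: cst_continuous|exact: continuous_sum].
  by apply/funext => t; rewrite bary0.
have subI : \bigcap_j (lam j @^-1` [set r | 0 < r]) `<=` simplex p.
  move=> y ly; apply/simplexP; exists ((y - p ord0) *m invmx (edges p)) => //.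
  by apply/ref_simplexP => j; apply/ltW/(ly j).
have oI : open (\bigcap_j (lam j @^-1` [set r | 0 < r])).
  rewrite openE => y ly; rewrite /interior /=.
  have H j : \forall z \near y, 0 < lam j z.
    have : open (lam j @^-1` [set r | 0 < r]).
      by apply: open_comp; [move=> z _; exact: clam|exact: open_gt].
    by rewrite openE; apply; exact: ly.
  have := filter_forall (nbhs_filter y) H.
  by apply: filterS => z lz j _; exact: lz.
apply: (interiorS subI); rewrite ((interior_id _).1 oI) => j _ /=.
have sE : \sum_i (e * k.+1%:R^-1 + (1 - e) * l i) = 1.
  rewrite big_split /= -[X in _ + X]mulr_sumr l1 mulr1 sumr_const card_ord.
  by rewrite -mulrnAr -(mulr_natl _ k.+1) mulfV ?pnatr_eq0// mulr1 addrC subrK.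
have -> : lam j (e *: centroid p + (1 - e) *: x) = e * k.+1%:R^-1 + (1 - e) * l j.
  apply: (affine_independent (p := p) (l := lam^~ _)
    (l' := fun j => e * k.+1%:R^-1 + (1 - e) * l j)) => //.
  - by rewrite row_free_unit.
  - exact: bary_sum.
  - rewrite -sparamE lamK xE /centroid !scaler_sumr -big_split /=.
    by apply: eq_bigr => i _; rewrite !scalerA scalerDl.
by rewrite ltr_pwDl ?mulr_gt0 ?mulr_ge0 ?subr_ge0.
Qed.

Lemma simplex_closure_interior k (p : 'I_k.+1 -> 'rV[R]_k) :
  edges p \in unitmx -> simplex p `<=` closure (simplex p)°.
Proof.
move=> up x px.
have cf : continuous (fun e : R => e *: centroid p + (1 - e) *: x).
  rewrite (_ : (fun e => _) = fun e : R => x + e *: (centroid p - x)).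
    move=> e; apply: cvgD; first exact: cvg_cst.
    exact: scalel_continuous.
  by apply/funext => e; rewrite scalerBl scale1r scalerBr addrCA.
have /(_ 0) := cf; rewrite /continuous_at scale0r subr0 scale1r add0r => cf0.
move=> B /cf0 /nbhs_ballP[e /= e0 eB].
pose e' := Num.min (e / 2) 1.
have e'0 : 0 < e' by rewrite lt_min divr_gt0//= ltr01.
exists (e' *: centroid p + (1 - e') *: x); split.
  by apply: simplex_contract => //; rewrite e'0 ge_min lexx orbT.
apply: eB; rewrite -ball_normE/= sub0r normrN gtr0_norm//.
by rewrite (@le_lt_trans _ _ (e / 2))// ?ge_min ?lexx// ltr_pdivrMr// ltr_pMr// ltr1n.
Qed.

Lemma simplex_refv k : simplex (@refv R k) = @ref_simplex R k.
Proof.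
apply/seteqP; split=> [x /simplexP[t St ->]|t St]; first by rewrite sparam_refv.
by apply/simplexP; exists t; rewrite ?sparam_refv.
Qed.

(** The argument takes place on the reference simplex, which is full-dimensional; this covers faces,
    whose interior in the ambient space is empty. *)
Lemma ref_int_eq0 n k (p : 'I_k.+1 -> 'rV[R]_n) (g : 'rV[R]_n -> R) :
  continuous g -> (forall x, simplex p x -> 0 <= g x) -> ref_int p g = 0 ->
  forall x, simplex p x -> g x = 0.
Proof.
move=> cg g0 ig x /simplexP[t St ->].
apply: (continuous_ge0_Rintegral_eq0 (@compact_ref_simplex R k)
  (continuous_comp_sparam (p := p) cg) _ ig).
  by move=> u Su; apply: g0; apply/simplexP; exists u.
rewrite -simplex_refv; apply: simplex_closure_interior; last by rewrite simplex_refv.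
by rewrite edges_refv unitmx1.
Qed.

(* Contracting by 1 - e towards the centroid maps the simplex into its
   interior and scales volumes by (1 - e)^k. *)
Lemma simplex_boundary_null k (p : 'I_k.+1 -> 'rV[R]_k) : edges p \in unitmx ->
  mu k (simplex p `\` (simplex p)°) = 0%E.
Proof.
move=> up; set S := simplex p.
have mS : measurable S by apply: compact_measurable_rV; exact: compact_simplex.
have mS' : measurable S° by apply: open_measurable_rV; exact: open_interior.
have Soo : (mu k S < +oo)%E by apply: compact_lebesgue_lty; exact: compact_simplex.
have S'S : S° `<=` S by exact: interior_subset.
have S'oo : (mu k S° < +oo)%E by apply: le_lt_trans Soo; apply: le_measure; rewrite ?inE.
have fS : mu k S \is a fin_num by rewrite ge0_fin_numE.
have fS' : mu k S° \is a fin_num by rewrite ge0_fin_numE.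
have key e : 0 < e < 1 -> (1 - e) ^+ k * fine (mu k S) <= fine (mu k S°).
  move=> /andP[e0 e1].
  have uM : ((1 - e)%:M : 'M[R]_k) \in unitmx.
    by rewrite unitmxE det_scalar unitfE expf_neq0// subr_eq0 gt_eqF.
  rewrite -lee_fin EFinM !fineK// (lebesgue_rV_affine (e *: centroid p) uM mS').
  have e1' : 0 <= 1 - e by rewrite subr_ge0 ltW.
  rewrite det_scalar ger0_norm ?exprn_ge0//.
  have mA : measurable [set t : 'rV[R]_k | S° (e *: centroid p + t *m (1 - e)%:M)].
    have := measurable_mulmxD ((1 - e)%:M : 'M[R]_k) (e *: centroid p).
    move=> /(_ measurableT _ mS'); rewrite setTI.
    by congr measurable; apply/seteqP; split=> t /=; rewrite addrC.
  apply: lee_wpmul2l; first by rewrite lee_fin exprn_ge0.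
  apply: le_measure; rewrite ?inE// => t St /=.
  by rewrite mul_mx_scalar; apply: simplex_contract => //; rewrite e0 ltW.
have le_S : fine (mu k S) <= fine (mu k S°).
  apply/ler_addgt0Pl => r r0.
  (* By Bernoulli's inequality the contraction loses at most the volume [e * B]. The bound r / (B +
     1) on [e] makes this at most [r], also when [B] is 0, and the bound 1 / 2 keeps [e] below 1. *)
  pose B := k%:R * fine (mu k S).
  have B0 : 0 <= B by rewrite mulr_ge0// fine_ge0.
  pose e := Num.min (r / (B + 1)) (1 / 2).
  have e0 : 0 < e by rewrite lt_min !divr_gt0// ltr_wpDl.
  have e1 : e < 1 by rewrite gt_min; apply/orP; right; lra.
  have H1 : (1 - e) ^+ k * fine (mu k S) <= fine (mu k S°) by apply: key; rewrite e0.
  have bern : 1 - k%:R * e <= (1 - e) ^+ k.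
    elim: (k) => [|j IH]; first by rewrite mul0r subr0 expr0.
    have e1' : 0 <= 1 - e by rewrite subr_ge0 ltW.
    have := ler_wpM2l e1' IH; rewrite -exprS; apply: le_trans.
    have : 0 <= j%:R * e * e by rewrite !mulr_ge0// ltW.
    by rewrite -natr1; lra.
  have H2 : (1 - k%:R * e) * fine (mu k S) <= (1 - e) ^+ k * fine (mu k S).
    by apply: ler_wpM2r => //; rewrite fine_ge0.
  have H3 : k%:R * e * fine (mu k S) <= r.
    rewrite mulrAC -/B; apply: (@le_trans _ _ (B * (r / (B + 1)))).
      by apply: ler_wpM2l => //; rewrite ge_min lexx.
    by rewrite mulrCA ger_pMr// ler_pdivrMr ?mul1r ?lerDl// ltr_wpDl.
  by lra.
rewrite measureD// setIidr//.
by apply/eqP; rewrite -[X in (X - _)%E]fineK// -[X in (_ - X)%E]fineK// -EFinB eqe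
  subr_eq0 eq_le le_S fine_le// le_measure ?inE.
Qed.

(** Rules out slits: a Lipschitz domain lies locally on one side of its boundary. If [x] were
    interior to the closure but outside [D], points strictly below the graph near [x] would be
    limits of points of [D], while [D] stays above the graph there. *)
Lemma interior_closure_lipschitz d (D : set 'rV[R]_d.+1) : open D ->
  lipschitz_boundary D -> (closure D)° `<=` D.
Proof.
move=> oD lD x cDx; apply: contrapT => nDx.
have [|Q [g [L [e [QQ lg e0 DP]]]]] := lD x.
  by split; [exact: interior_subset|rewrite ((interior_id _).1 oD)].
have cg : continuous g.
  move=> z; apply/(@cvgrPdist_lt _ _ _ (nbhs z) (nbhs_filter z)) => r r0.
  apply/nbhs_ballP.
  have L0 : 0 < `|L| + 1 by rewrite ltr_wpDl.
  exists (r / (`|L| + 1)); first by rewrite /= divr_gt0.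
  move=> y; rewrite -ball_normE/= ltr_pdivlMr// => zy.
  have /= := lg (z, y) (conj I I); rewrite /self_sub /= => /le_lt_trans; apply.
  apply: le_lt_trans zy; rewrite mulrC ler_wpM2l// (le_trans (ler_norm _))//.
  by rewrite lerDl.
have czQ i : continuous (fun y : 'rV[R]_d.+1 => (y *m Q) 0 i).
  have cQ := @continuous_mulmxD _ _ _ Q 0.
  move=> y; rewrite (_ : (fun y => _) = (fun z : 'rV[R]_d.+1 => z 0 i) \o
      (fun y : 'rV[R]_d.+1 => 0 + y *m Q)).
    by apply: continuous_comp; [exact: cQ|exact: coord_continuous].
  by apply/funext => z /=; rewrite add0r.
have ccol : continuous (fun y : 'rV[R]_d.+1 => col' ord0 (y *m Q)).
  apply: continuous_rVP => i; under eq_fun do rewrite [col' _ _ _ _]mxE.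
  exact: czQ.
have cen : continuous (fun y : 'rV[R]_d.+1 => enorm (y - x)).
  move=> y; apply: (@continuous_comp _ _ _ (fun y : 'rV[R]_d.+1 => dot (y - x) (y - x))
    (@Num.sqrt R)); last exact: sqrt_continuous.
  have cc i : continuous (fun y : 'rV[R]_d.+1 => (y - x) 0 i).
    rewrite (_ : (fun y => _) = fun y : 'rV[R]_d.+1 => y 0 i - x 0 i).
      move=> z.
      exact: (continuousB (@coord_continuous R 1 d.+1 0 i z) (@cst_continuous _ _ (x 0 i) z)).
    by apply/funext => z; rewrite !mxE.
  by apply: continuous_sum => i; exact: continuous_mulr.
pose h (y : 'rV[R]_d.+1) := g (col' ord0 (y *m Q)) - (y *m Q) 0 ord0.
have ch : continuous h.
  have cgc : continuous (g \o (fun y : 'rV[R]_d.+1 => col' ord0 (y *m Q))).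
    by move=> y; apply: continuous_comp; [exact: ccol|exact: cg].
  by move=> y; exact: (continuousB (cgc y) (czQ ord0 y)).
have en0 : enorm (x - x) = 0.
  by rewrite /enorm subrr dotE mul0mx mxE sqrtr0.
have hx : 0 <= h x.
  rewrite subr_ge0 leNgt; apply/negP => xD; apply: nDx; apply/DP => //.
  by rewrite en0.
(* Moves [x] down the vertical axis of the rotated coordinates, which raises [h] by exactly [t]. *)
pose yt (t : R) : 'rV[R]_d.+1 := x - t *: (delta_mx 0 ord0 *m Q^T).
have ytQ t : yt t *m Q = x *m Q - t *: delta_mx 0 ord0.
  rewrite mulmxBl -scalemxAl -mulmxA; congr (_ - _ *: _).
  by rewrite (mulmx1C QQ) mulmx1.
have hyt t : h (yt t) = h x + t.
  rewrite /h ytQ; have -> : col' ord0 (x *m Q - t *: delta_mx 0 ord0) = col' ord0 (x *m Q).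
    by apply/rowP => i; rewrite !mxE /= mulr0 subr0.
  by rewrite !mxE !eqxx /= mulr1 opprB addrA addrAC.
have cyt : continuous yt.
  move=> t.
  exact: (continuousB (@cst_continuous _ _ x t)
    (@scalel_continuous _ _ (delta_mx 0 ord0 *m Q^T) t)).
have : nbhs x (closure D `&` [set y | enorm (y - x) < e]).
  apply: filterI => //.
  have : nbhs (enorm (x - x)) [set r | r < e].
    by rewrite en0; apply: open_nbhs_nbhs; split=> //; exact: open_lt.
  exact: cen.
have yt0 : yt 0 = x by rewrite /yt scale0r subr0.
rewrite -{1}yt0 => /cyt/nbhs_ballP[r /= r0 rP].
have [] := rP (r / 2).
  rewrite -ball_normE/= sub0r normrN gtr0_norm ?divr_gt0//.
  by rewrite ltr_pdivrMr// ltr_pMr// ltr1n.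
move=> cDy ey.
have [z [Dz [ez hz]]] : D `&` ([set y | enorm (y - x) < e] `&` [set y | 0 < h y]) !=set0.
  apply: cDy; apply: open_nbhs_nbhs; split.
    have o1 : open ((fun y : 'rV[R]_d.+1 => enorm (y - x)) @^-1` [set r | r < e]).
      by apply: open_comp; [move=> z _; exact: cen|exact: open_lt].
    have o2 : open (h @^-1` [set r | 0 < r]).
      by apply: open_comp; [move=> z _; exact: ch|exact: open_gt].
    exact: openI o1 o2.
  by split => //=; rewrite hyt ltr_wpDl// divr_gt0.
by have := (DP z ez).1 Dz; apply/negP; rewrite -leNgt -subr_ge0 ltW.
Qed.

End simplex_geometry.

(** * Riesz representatives and the weak gradient *)

(** The matrix may be singular. By symmetry the columns of its cokernel are null vectors of the
    quadratic form, so [l] is orthogonal to them, which is membership in the row space. *)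
Lemma gram_represent (F : fieldType) N (A : 'M[F]_N) (l : 'rV[F]_N) : A^T = A ->
  (forall c : 'rV[F]_N, c *m A *m c^T = 0 -> c *m l^T = 0) ->
  exists c : 'rV[F]_N, c *m A = l.
Proof.
move=> symA nullA; suff /submxP[c ->] : (l <= A)%MS by exists c.
rewrite submxE -[_ *m _]trmxK trmx_mul; apply/eqP.
suff -> : (cokermx A)^T *m l^T = 0 by rewrite trmx0.
apply/row_matrixP => i; rewrite row_mul row0; apply: nullA.
rewrite -row_mul -[X in row i (_ *m X)]symA -trmx_mul mulmx_coker trmx0.
by rewrite row0 mul0mx.
Qed.

Section riesz.
Variables (R : realType) (d : nat).
Local Notation poly := (mpoly.mpoly d.+1 R).

Lemma riesz_deg_le (gamma : nat) (B : poly -> poly -> R) (L : poly -> R) :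
  (forall a x y z, B (a *: x + y) z = a * B x z + B y z) ->
  (forall x y, B x y = B y x) ->
  (forall a x y, L (a *: x + y) = a * L x + L y) ->
  (forall x, deg_le gamma x -> B x x = 0 -> L x = 0) ->
  exists2 g, deg_le gamma g & forall s, deg_le gamma s -> B g s = L s.
Proof.
move=> Blin Bsym Llin null.
(* [bmultinom] bounds the degree strictly, and [mmeasure] of a nonzero polynomial is its degree plus
   one; both conventions put the bound [gamma.+1] on degree at most [gamma]. *)
pose I := bmultinom d.+1 gamma.+1.
pose N := #|{: I}|.
pose e (i : 'I_N) : poly := mpolyX R (bmnm (enum_val i)).
have B0 z : B 0 z = 0.
  have := Blin 1 0 0 z; rewrite scaler0 addr0 mul1r => /eqP.
  by rewrite -subr_eq0 opprD addNKr oppr_eq0 => /eqP.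
have L0 : L 0 = 0.
  have := Llin 1 0 0; rewrite scaler0 addr0 mul1r => /eqP.
  by rewrite -subr_eq0 opprD addNKr oppr_eq0 => /eqP.
have Bsum (c : 'I_N -> R) z : B (\sum_i c i *: e i) z = \sum_i c i * B (e i) z.
  elim: (index_enum _) => [|i s IH]; first by rewrite !big_nil.
  by rewrite !big_cons Blin IH.
have Lsum (c : 'I_N -> R) : L (\sum_i c i *: e i) = \sum_i c i * L (e i).
  elim: (index_enum _) => [|i s IH]; first by rewrite !big_nil.
  by rewrite !big_cons Llin IH.
have dege (c : 'I_N -> R) : deg_le gamma (\sum_i c i *: e i).
  rewrite /deg_le; apply: leq_trans (mmeasure_sum _ _ _ _) _.
  apply/bigmax_leqP => i _; apply: leq_trans (mmeasureZ_le _ _ _) _.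
  by rewrite mmeasureX; exact: bmdeg.
have sE s : deg_le gamma s -> exists c : 'I_N -> R, s = \sum_i c i *: e i.
  move=> ds; exists (fun i => mcoeff (bmnm (enum_val i)) s).
  rewrite {1}(mpolywE ds).
  by rewrite (reindex _ (onW_bij _ (enum_val_bij I))).
pose A := \matrix_(i, j) B (e i) (e j) : 'M[R]_N.
pose l := \row_i L (e i) : 'rV[R]_N.
have symA : A^T = A by apply/matrixP => i j; rewrite !mxE Bsym.
have [c cE] : exists c : 'rV[R]_N, c *m A = l.
  apply: gram_represent => // c cAc; apply/matrixP => i j; rewrite !ord1 [RHS]mxE.
  have : B (\sum_i c 0 i *: e i) (\sum_i c 0 i *: e i) = 0.
    have := congr1 (fun M : 'M[R]_1 => M 0 0) cAc; rewrite [RHS]mxE => <-.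
    rewrite -mulmxA mxE Bsum; apply: eq_bigr => k _; congr (_ * _).
    rewrite Bsym Bsum mxE; apply: eq_bigr => k' _; rewrite !mxE mulrC.
    by rewrite Bsym.
  move/(null _ (dege _)); rewrite Lsum => <-.
  by rewrite mxE; apply: eq_bigr => k _; rewrite !mxE.
exists (\sum_i c 0 i *: e i) => // s /sE[c' ->].
rewrite Bsym Bsum Lsum; apply: eq_bigr => k _; congr (_ * _).
have := congr1 (fun M : 'rV[R]_N => M 0 k) cE; rewrite !mxE => <-.
by rewrite Bsym Bsum; apply: eq_bigr => k' _; rewrite mxE.
Qed.

End riesz.

Section integral_linearity.
Variable R : realType.
Local Notation mu := (lebesgue_rV R).

Lemma eq_simplex_int n k (p : 'I_k.+1 -> 'rV[R]_n) (g h : 'rV[R]_n -> R) :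
  (forall x, simplex p x -> g x = h x) -> simplex_int p g = simplex_int p h.
Proof. by move=> gh; rewrite !simplex_intE (eq_ref_int gh). Qed.

Lemma simplex_int_sum n k (p : 'I_k.+1 -> 'rV[R]_n) (I : Type) (s : seq I)
    (g : I -> 'rV[R]_n -> R) : (forall i, continuous (g i)) ->
  simplex_int p (fun x => \sum_(i <- s) g i x) = \sum_(i <- s) simplex_int p (g i).
Proof. by move=> cg; rewrite simplex_intE ref_int_sum// mulr_sumr. Qed.

Lemma simplex_intZ n k (p : 'I_k.+1 -> 'rV[R]_n) (a : R) (g : 'rV[R]_n -> R) :
  continuous g -> simplex_int p (fun x => a * g x) = a * simplex_int p g.
Proof.
move=> cg; rewrite !simplex_intE mulrCA [a * ref_int _ _]mulrC -ref_intZr//.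
by congr (_ * _); apply: eq_ref_int => x _; rewrite mulrC.
Qed.

Lemma simplex_intD n k (p : 'I_k.+1 -> 'rV[R]_n) (g h : 'rV[R]_n -> R) :
  continuous g -> continuous h ->
  simplex_int p (fun x => g x + h x) = simplex_int p g + simplex_int p h.
Proof.
move=> cg ch; pose f (b : bool) := if b then g else h.
have cf b : continuous (f b) by case: b.
have := simplex_int_sum p [:: true; false] cf.
rewrite !big_cons !big_nil addr0 /= => <-.
by apply: eq_simplex_int => x _; rewrite !big_cons big_nil addr0.
Qed.

Lemma integrable_simplex n k (p : 'I_k.+1 -> 'rV[R]_n) (g : 'rV[R]_n -> R) :
  continuous g -> (mu n).-integrable (simplex p) (EFin \o g).
Proof. by apply: continuous_integrable_rV; exact: compact_simplex. Qed.

Lemma measurable_simplex n k (p : 'I_k.+1 -> 'rV[R]_n) : measurable (simplex p).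
Proof. by apply: compact_measurable_rV; exact: compact_simplex. Qed.

End integral_linearity.

Section weak_gradient.
Variables (R : realType) (d : nat) (T : mesh R d).
Local Notation V := 'rV[R]_d.+1.
Local Notation poly := (mpoly.mpoly d.+1 R).
Local Notation mu := (lebesgue_rV R).

Lemma peval_lin (a : R) (b c : poly) (x : V) :
  peval (a *: b + c) x = a * peval b x + peval c x.
Proof. by rewrite /peval mevalD mevalZ. Qed.

Lemma pderiv_lin i (a : R) (b c : poly) :
  pderiv i (a *: b + c) = a *: pderiv i b + pderiv i c.
Proof. by rewrite /pderiv mderivD mderivZ. Qed.

Lemma continuous_peval (b : poly) : continuous (peval b).
Proof. by have [] := peval_C1 b. Qed.

Lemma Rintegral_lin n (D : set 'rV[R]_n) (a : R) (f g : 'rV[R]_n -> R) :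
  compact D -> continuous f -> continuous g ->
  \int[mu n]_(x in D) (a * f x + g x) =
  a * \int[mu n]_(x in D) f x + \int[mu n]_(x in D) g x.
Proof.
move=> cD cf cg; have mD := compact_measurable_rV cD.
rewrite -RintegralZl//; last exact: continuous_integrable_rV.
apply: RintegralD => //; apply: continuous_integrable_rV => //.
by apply: continuous_mulr => //; exact: cst_continuous.
Qed.

Lemma simplex_int_lin n k (p : 'I_k.+1 -> 'rV[R]_n) (a : R) (f g : 'rV[R]_n -> R) :
  continuous f -> continuous g ->
  simplex_int p (fun x => a * f x + g x) = a * simplex_int p f + simplex_int p g.
Proof.
move=> cf cg; rewrite -simplex_intZ// -simplex_intD//.
by apply: continuous_mulr => //; exact: cst_continuous.
Qed.

Lemma simplex_face n k (p : 'I_k.+2 -> 'rV[R]_n) j :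
  simplex (p \o lift j) `<=` simplex p.
Proof.
move=> x [l [l0 l1 ->]].
pose l' i := if unlift j i is Some i' then l i' else 0.
have l'j : l' j = 0 by rewrite /l' unlift_none.
have l'lift i : l' (lift j i) = l i by rewrite /l' liftK.
exists l'; split.
- by move=> i; rewrite /l'; case: unliftP => [i' _|_].
- by rewrite (bigD1_ord j)//= l'j add0r -l1; apply: eq_bigr => i _.
- rewrite [RHS](bigD1_ord j)//= l'j scale0r add0r.
  by apply: eq_bigr => i _; rewrite l'lift.
Qed.

Variable K : cell T.
Hypothesis ndK : Defs.nondegenerate (vtx K).

Lemma cell_unit : edges (vtx K) \in unitmx.
Proof. by rewrite -row_free_unit. Qed.

Lemma outward_normalP j : outward (vtx K) j (outward_normal K j).
Proof. exact: getPex (outward_exists cell_unit j). Qed.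

Lemma face_elt j : face K j `<=` elt K.
Proof. exact: (@simplex_face _ _ (vtx K) j). Qed.

Lemma cell_int_partial (G : V -> R) i : C1 G ->
  cell_int K (partial i G) =
  \sum_j simplex_int (fvtx K j) (fun x => G x * outward_normal K j 0 i).
Proof.
move=> C1G; rewrite /cell_int /elt.
apply: etrans (gauss_simplex cell_unit (delta_mx 0 i) C1G outward_normalP) _.
apply: eq_bigr => j _; apply: eq_simplex_int => x _; congr (_ * _).
rewrite /dot (bigD1 i)//= mxE !eqxx mul1r big1 ?addr0// => l li.
by rewrite mxE (negPf li) andbF mul0r.
Qed.

Lemma cell_int_eq0 (g : V -> R) : continuous g -> (forall x, elt K x -> 0 <= g x) ->
  cell_int K g = 0 -> forall x, elt K x -> g x = 0.
Proof.
move=> cg g0 ig x Kx.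
apply: (continuous_ge0_Rintegral_eq0 (@compact_simplex _ _ _ (vtx K)) cg g0 ig).
exact: simplex_closure_interior cell_unit _ Kx.
Qed.

Lemma wgradP gamma (q : wfun T R) (H : V -> R) (h : 'I_d.+2 -> V -> R) :
  C1 H -> (forall x, elt K x -> wi q K x = H x) ->
  (forall j, continuous (h j)) -> (forall j x, face K j x -> wb q (face K j) x = h j x) ->
  forall s, vdeg_le gamma s ->
    cell_int K (fun x => dot (vpeval (wgrad gamma q K) x) (vpeval s x)) =
    - cell_int K (fun x => H x * peval (Defs.pdiv s) x)
    + bnd_int K (fun j x => h j x * dot (vpeval s x) (outward_normal K j)).
Proof.
move=> C1H qH ch qh; have [cH _ _] := C1H.
have cK : compact (elt K) by exact: compact_simplex.
pose nu j := outward_normal K j.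
pose B (a b : poly) := cell_int K (fun x => peval a x * peval b x).
pose L i (b : poly) := - cell_int K (fun x => H x * peval (pderiv i b) x) +
  \sum_j simplex_int (fvtx K j) (fun x => h j x * (peval b x * nu j 0 i)).
have cp := continuous_peval.
have chn j i (b : poly) : continuous (fun x => h j x * (peval b x * nu j 0 i)).
  apply: continuous_mulr => //; apply: continuous_mulr => //.
  exact: cst_continuous.
have Blin a x y z : B (a *: x + y) z = a * B x z + B y z.
  rewrite /B /cell_int -Rintegral_lin//; try exact: continuous_mulr.
  by apply: eq_Rintegral => t _; rewrite peval_lin mulrDl mulrA.
have Bsym x y : B x y = B y x.
  by apply: eq_Rintegral => t _; rewrite mulrC.
have Llin i a x y : L i (a *: x + y) = a * L i x + L i y.
  rewrite /L; have -> : cell_int K (fun t => H t * peval (pderiv i (a *: x + y)) t) =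
      a * cell_int K (fun t => H t * peval (pderiv i x) t) +
      cell_int K (fun t => H t * peval (pderiv i y) t).
    rewrite /cell_int -Rintegral_lin//; try exact: continuous_mulr.
    by apply: eq_Rintegral => t _; rewrite pderiv_lin peval_lin mulrDr mulrCA.
  rewrite (eq_bigr (fun j =>
      a * simplex_int (fvtx K j) (fun t => h j t * (peval x t * nu j 0 i)) +
      simplex_int (fvtx K j) (fun t => h j t * (peval y t * nu j 0 i)))); last first.
    move=> j _; rewrite -simplex_int_lin//.
    by apply: eq_simplex_int => t _; rewrite peval_lin; ring.
  by rewrite big_split /= -mulr_sumr; ring.
have null i b : deg_le gamma b -> B b b = 0 -> L i b = 0.
  move=> _ Bbb.
  have b0 x : elt K x -> peval b x = 0.
    move=> Kx; have := cell_int_eq0 (continuous_mulr (cp b) (cp b)) _ Bbb Kx.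
    move=> /(_ _)/eqP; rewrite mulf_eq0 orbb => bx; apply/eqP/bx => y _.
    by rewrite -expr2 sqr_ge0.
  rewrite /L big1 ?addr0 => [|j _]; last first.
    (* The zero integrand is written as a product so that [simplex_intZ] pulls out the factor 0. *)
    rewrite (eq_simplex_int (h := fun=> 0 * 0)); first by rewrite simplex_intZ ?mul0r//; exact: cst_continuous.
    by move=> x jx; rewrite (b0 _ (face_elt jx)); ring.
  (* The derivative of [b] is not examined pointwise: the divergence theorem for [H * b] leaves only
     face terms, where [b] vanishes, and the product rule leaves [H] times the derivative of [b]
     inside [K]. *)
  have E : cell_int K (partial i (fun x => H x * peval b x)) = 0.
    rewrite cell_int_partial; last exact: C1M C1H (peval_C1 b).
    rewrite big1// => j _.
    rewrite (eq_simplex_int (h := fun=> 0 * 0)); first by rewrite simplex_intZ ?mul0r//; exact: cst_continuous.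
    by move=> x jx; rewrite (b0 _ (face_elt jx)); ring.
  apply/eqP; rewrite oppr_eq0 -E; apply/eqP; apply: eq_Rintegral => x /set_mem Kx.
  by rewrite (partialM _ _ C1H (peval_C1 b)) partial_peval b0// mul0r addr0.
(* The functional splits over the components of the test field, so each component of the gradient is
   represented separately. *)
have /choice[g gP] : forall i, exists g, deg_le gamma g /\
    forall s, deg_le gamma s -> B g s = L i s.
  by move=> i; have [g] := riesz_deg_le Blin Bsym (Llin i) (null i); exists g.
suff ex : exists G : 'rV[poly]_d.+1, [set G | vdeg_le gamma G /\ forall s, vdeg_le gamma s ->
    cell_int K (fun x => dot (vpeval G x) (vpeval s x)) =
    - cell_int K (fun x => wi q K x * peval (Defs.pdiv s) x)
    + bnd_int K (fun j x =>
        wb q (face K j) x * dot (vpeval s x) (outward_normal K j))] G.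
  have [_ GP] := xgetPex 0 ex; move=> s ds; rewrite /wgrad (GP s ds); congr (- _ + _).
    by apply: eq_Rintegral => x /set_mem Kx; rewrite qH.
  by apply: eq_bigr => j _; apply: eq_simplex_int => x jx; rewrite qh.
exists (\row_i g i); split=> [i|s ds]; first by rewrite mxE; have [] := gP i.
rewrite (_ : cell_int K (fun x => wi q K x * _) =
    cell_int K (fun x => H x * peval (Defs.pdiv s) x)); last first.
  by apply: eq_Rintegral => x /set_mem Kx; rewrite qH.
rewrite (_ : bnd_int K _ =
    bnd_int K (fun j x => h j x * dot (vpeval s x) (nu j))); last first.
  by apply: eq_bigr => j _; apply: eq_simplex_int => x jx; rewrite qh.
transitivity (\sum_i B (g i) (s 0 i)).
  rewrite /B /cell_int -Rintegral_sum; last 2 first.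
  - exact: compact_measurable_rV.
  - by move=> i; apply: continuous_integrable_rV => //; exact: continuous_mulr.
  by apply: eq_Rintegral => x _; apply: eq_bigr => i _; rewrite !mxE.
rewrite (eq_bigr (fun i => L i (s 0 i))); last by move=> i _; have [_ ->] := gP i.
rewrite big_split /= sumrN; congr (- _ + _).
  rewrite /cell_int -Rintegral_sum; last 2 first.
  - exact: compact_measurable_rV.
  - by move=> i; apply: continuous_integrable_rV => //; exact: continuous_mulr.
  apply: eq_Rintegral => x _; rewrite -mulr_sumr; congr (_ * _).
  by rewrite /peval /Defs.pdiv raddf_sum.
rewrite exchange_big /=; apply: eq_bigr => j _.
rewrite -simplex_int_sum//; apply: eq_simplex_int => x _.
by rewrite -mulr_sumr; congr (_ * _); apply: eq_bigr => i _; rewrite mxE.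
Qed.

End weak_gradient.

(** * Integrals of piecewise functions and conclusion *)

Section piecewise.
Variables (R : realType) (d : nat) (T : mesh R d).
Local Notation V := 'rV[R]_d.+1.
Local Notation mu := (lebesgue_rV R).
Variable Omega : set V.
Hypothesis oOmega : open Omega.
Hypothesis intOmega : (closure Omega)° `<=` Omega.
Hypothesis hT : partitions T Omega.

Lemma interior_elt_sub (K : cell T) : (elt K)° `<=` Omega.
Proof.
have [_ TE _] := hT.
by apply: subset_trans intOmega; apply: interiorS; rewrite -TE => x Kx; exists K.
Qed.

Lemma piecewiseE (F : cell T -> V -> R) x :
  piecewise F x = \sum_K (F K \_ ((elt K)°)) x.
Proof.
have [_ _ dT] := hT; rewrite /piecewise; case: pickP => [K /asboolP Kx|noK].
  rewrite (bigD1 K)//= patchE mem_set// big1 ?addr0// => K' K'K.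
  rewrite patchE; case: ifPn => // /set_mem K'x.
  by have : ((elt K')° `&` (elt K)°) x by []; rewrite dT.
rewrite big1// => K _; rewrite patchE; case: ifPn => // /set_mem Kx.
by have := noK K; rewrite asboolT.
Qed.

Lemma piecewise_dot (g h : cell T -> V -> V) x :
  dot (piecewise g x) (piecewise h x) = piecewise (fun K x => dot (g K x) (h K x)) x.
Proof.
rewrite /piecewise; case: pickP => // _.
by rewrite dotE mul0mx mxE.
Qed.

Lemma measurable_interior_elt (K : cell T) : measurable (elt K)°.
Proof. by apply: open_measurable_rV; exact: open_interior. Qed.

Lemma measurable_elt (K : cell T) : measurable (elt K).
Proof. exact: measurable_simplex. Qed.

(** [F] is controlled only on the elements; its continuous counterpart [H] supplies measurability
    and integrability. *)
Variable F : cell T -> V -> R.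
Variable H : cell T -> V -> R.
Hypothesis cH : forall K, continuous (H K).
Hypothesis FH : forall K x, elt K x -> F K x = H K x.

Let FHr K : F K \_ ((elt K)°) = H K \_ ((elt K)°).
Proof.
apply/funext => x; rewrite !patchE; case: ifPn => // /set_mem Kx.
by apply: FH; exact: interior_subset.
Qed.

Let integrable_interior (G : V -> R) (K : cell T) : continuous G ->
  (mu d.+1).-integrable (elt K)° (EFin \o G).
Proof.
move=> cG; apply: (integrableS (measurable_elt K)).
- exact: measurable_interior_elt.
- exact: interior_subset.
- exact: integrable_simplex.
Qed.

(** [piecewise] vanishes off the element interiors, which are disjoint and contained in [Omega];
    passing from them to the closed elements adds null sets only. *)
Lemma Rintegral_piecewise :
  \int[mu d.+1]_(x in Omega) piecewise F x = \sum_K cell_int K (F K).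
Proof.
have mO := open_measurable_rV oOmega.
transitivity (\int[mu d.+1]_(x in Omega) \sum_K (H K \_ ((elt K)°)) x).
  apply: eq_Rintegral => x _; rewrite piecewiseE.
  by apply: eq_bigr => K _; rewrite FHr.
rewrite Rintegral_sum//; last first.
  move=> K; rewrite -restrict_EFin; apply: (integrable_restrict _ _ _ _).1 => //.
    exact: measurable_interior_elt.
  by rewrite setIidr; [exact: integrable_interior|exact: interior_elt_sub].
apply: eq_bigr => K _; rewrite -Rintegral_mkcondr setIidr; last exact: interior_elt_sub.
have [ndT _ _] := hT.
transitivity (cell_int K (H K)); last first.
  by apply: eq_Rintegral => x /set_mem Kx; rewrite FH.
rewrite /cell_int /Rintegral; congr fine.
have mI := measurable_interior_elt K; have mK := measurable_elt K.
rewrite [RHS](@negligible_integral _ _ _ _ _ (elt K `\` (elt K)°)) //.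
- by rewrite setDD setIidr//; exact: interior_subset.
- exact: measurableD.
- exact: integrable_simplex.
- by apply: simplex_boundary_null; rewrite -row_free_unit; exact: ndT.
Qed.

Lemma L2_piecewise : L2 Omega (piecewise F).
Proof.
rewrite /L2.
have -> : piecewise F \_ Omega = \sum_K (H K \_ ((elt K)°)).
  apply/funext => x; rewrite patchE fct_sumE; case: ifPn => [_|/negP nOx].
    by rewrite piecewiseE; apply: eq_bigr => K _; rewrite FHr.
  rewrite big1// => K _; rewrite patchE; case: ifPn => // /set_mem Kx.
  by exfalso; apply: nOx; apply/mem_set/(interior_elt_sub Kx).
have p1 : (1 <= 2%:E :> \bar R)%E by rewrite lee_fin ler1n.
have [L0 LD] := Lfun_addr_closed (mu d.+1) p1.
apply: (big_ind (fun f => f \in Lfun (mu d.+1) 2%:E)); [exact: L0|move=> f g; exact: LD|].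
move=> K _; have mI := measurable_interior_elt K.
have mf : measurable_fun setT (H K \_ ((elt K)°)).
  have mH := continuous_measurable_rV (@cH K).
  by apply: (measurable_restrictT _ mI).1; exact: measurable_funTS mH.
rewrite inE; apply/andP; split; rewrite inE//= /finite_norm unlock.
apply: poweR_lty.
have cHH : continuous (fun x => H K x * H K x) by exact: continuous_mulr.
have /integrableP[_] := (integrable_mkcond _ mI).1 (integrable_interior K cHH).
apply: le_lt_trans; rewrite le_eqVlt; apply/orP; left; apply/eqP.
apply: eq_integral => x _; rewrite /= !patchE; case: ifPn => _ /=.
  by rewrite powR_mulrn// -normrX expr2.
by rewrite !normr0 powR0.
Qed.

End piecewise.

(** * The two pressure tests and the distributional divergence *)

Section assembly.
Variables (R : realType) (d : nat) (T : mesh R d).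
Local Notation V := 'rV[R]_d.+1.
Local Notation poly := (mpoly.mpoly d.+1 R).
Local Notation mu := (lebesgue_rV R).
Variable Omega : set V.
Hypothesis oOmega : open Omega.
Hypothesis intOmega : (closure Omega)° `<=` Omega.
Hypothesis hT : partitions T Omega.

Let ndT (K : cell T) : Defs.nondegenerate (vtx K).
Proof. by have [+ _ _] := hT; exact. Qed.

Variables (u : wfun T V) (m : nat).
Hypothesis hm : (0 < m)%N.
Variable U : cell T -> 'rV[poly]_d.+1.
Hypothesis degU : forall K, vdeg_le m (U K).
Hypothesis uU : forall K x, elt K x -> wi u K x = vpeval (U K) x.

Let flux (K : cell T) j (x : V) : R := dot (vpeval (U K) x) (outward_normal K j).

Let continuous_flux (K : cell T) j : continuous (flux K j).
Proof.
apply: continuous_sum => i; apply: continuous_mulr; last exact: cst_continuous.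
by under eq_fun do rewrite [vpeval _ _ _ _]mxE; exact: continuous_peval.
Qed.

Lemma continuous_dot_vpeval (P Q : 'rV[poly]_d.+1) :
  continuous (fun x => dot (vpeval P x) (vpeval Q x)).
Proof.
apply: continuous_sum => i; apply: continuous_mulr;
  by under eq_fun do rewrite [vpeval _ _ _ _]mxE; exact: continuous_peval.
Qed.

Lemma bhE (q : wfun T R) (H : cell T -> V -> R) (h : cell T -> 'I_d.+2 -> V -> R) :
  (forall K, C1 (H K)) -> (forall K x, elt K x -> wi q K x = H K x) ->
  (forall K j, continuous (h K j)) ->
  (forall K j x, face K j x -> wb q (face K j) x = h K j x) ->
  bh Omega m u q = \sum_K (- cell_int K (fun x => H K x * peval (Defs.pdiv (U K)) x)
    + \sum_j simplex_int (fvtx K j) (fun x => h K j x * flux K j x)).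
Proof.
move=> C1H qH ch qh; rewrite /bh /inner.
under eq_Rintegral do rewrite piecewise_dot.
rewrite (Rintegral_piecewise oOmega intOmega hT
  (H := fun K x => dot (vpeval (wgrad m q K) x) (vpeval (U K) x))).
- apply: eq_bigr => K _.
  rewrite -(wgradP (ndT K) (C1H K) (qH K) (ch K) (qh K) (degU K)).
  by apply: eq_Rintegral => x /set_mem Kx; rewrite uU.
- by move=> K; exact: continuous_dot_vpeval.
- by move=> K x Kx; rewrite uU.
Qed.

Let incidence := (cell T * 'I_d.+2)%type.
Let fc (a : incidence) : set V := face a.1 a.2.
Let sint (a : incidence) (g : V -> R) : R := simplex_int (fvtx a.1 a.2) g.
Let fl (a : incidence) := flux a.1 a.2.

(** A sum and not a difference, since each flux is taken along the outward normal of its own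
    element. It is indexed by the face as a set, hence single-valued and usable as a [wb]
    component. *)
Definition jump (e : set V) (x : V) : R :=
  \sum_(a : cell T * 'I_d.+2 | `[< face a.1 a.2 = e >])
    dot (vpeval (U a.1) x) (outward_normal a.1 a.2).

Lemma continuous_jump e : continuous (jump e).
Proof.
rewrite (_ : jump e = fun x => \sum_(a : incidence) (`[< fc a = e >]%:R * fl a x)).
  apply: continuous_sum => a; apply: continuous_mulr; first exact: cst_continuous.
  exact: continuous_flux.
apply/funext => x; rewrite /jump big_mkcond; apply: eq_bigr => a _.
by rewrite /fc /fl /flux; case: asboolP; rewrite ?mul1r ?mul0r.
Qed.

(* Elements sharing a face contribute the same surface integral, so the
   fluxes through it may be replaced by the average of their sum, the jump. *)
Lemma sum_flux_jump (psi : set V -> V -> R) : (forall e, continuous (psi e)) ->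
  \sum_K \sum_j simplex_int (fvtx K j) (fun x => psi (face K j) x * flux K j x) =
  \sum_(a : incidence) (#|[pred b | `[< fc b = fc a >]]|%:R)^-1 *
    sint a (fun x => psi (fc a) x * jump (fc a) x).
Proof.
move=> cpsi; rewrite pair_big /=.
have cpf e a : continuous (fun x => psi e x * fl a x).
  by apply: continuous_mulr => //; exact: continuous_flux.
have sintE (a b : incidence) g : fc b = fc a -> continuous g -> sint a g = sint b g.
  move=> ab cg; apply: simplex_int_set => //.
  exact: row_free_face (cell_unit (ndT a.1)) a.2.
pose N a : R := #|[pred b | `[< fc b = fc a >]]|%:R.
have jumpE a : sint a (fun x => psi (fc a) x * jump (fc a) x) =
    \sum_(b | `[< fc b = fc a >]) sint b (fun x => psi (fc b) x * fl b x).
  (* The filtered sum is turned into a sum over a list, the form that [simplex_int_sum] handles. *)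
  transitivity (sint a (fun x => \sum_(b <- enum [pred b | `[< fc b = fc a >]])
      psi (fc a) x * fl b x)).
    apply: eq_simplex_int => x _.
    by rewrite big_enum_cond -mulr_sumr; under [in RHS]eq_bigl do rewrite andbT.
  apply: etrans (simplex_int_sum (fvtx a.1 a.2) _ (cpf (fc a))) _.
  rewrite big_enum_cond; apply: eq_big => [b|b]; first by rewrite andbT.
  move=> /andP[/asboolP ba _]; rewrite -ba.
  exact: (sintE a b _ ba (cpf (fc b) b)).
rewrite [RHS](eq_bigr (fun a => \sum_b
    (if `[< fc b = fc a >] then (N a)^-1 * sint b (fun x => psi (fc b) x * fl b x) else 0))).
  (* Double counting: after the exchange, incidence [b] occurs once for each of the [N b] incidences
     with the same face, every time with weight 1 / [N b]. *)
  rewrite exchange_big /=; apply: eq_bigr => b _; rewrite -big_mkcond /=.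
  rewrite (eq_bigr (fun=> (N b)^-1 * sint b (fun x => psi (fc b) x * fl b x))).
    rewrite sumr_const -[RHS]mulr_natl mulrA (_ : _%:R = N b).
      rewrite mulfV ?mul1r// pnatr_eq0 -lt0n; apply/card_gt0P; exists b.
      exact: (asboolT erefl).
    congr (_%:R); apply: eq_card => a; rewrite !inE.
    by apply/asboolP/asboolP.
  by move=> a /asboolP ba; rewrite /N ba.
by move=> a _; rewrite jumpE -big_mkcond mulr_sumr.
Qed.

(** The Gram factor of a face is nonzero because, times a height, it equals the nonzero determinant
    of the element; the remaining factor is [ref_int]. *)
Lemma simplex_int_eq0 (K : cell T) j (g : V -> R) : continuous g ->
  (forall x, face K j x -> 0 <= g x) -> simplex_int (fvtx K j) g = 0 ->
  forall x, face K j x -> g x = 0.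
Proof.
move=> cg g0 /eqP; rewrite simplex_intE mulf_eq0 => /orP[/eqP s0|/eqP].
  have := face_gram_height (cell_unit (ndT K)) (outward_normalP (ndT K) j)
    (l := lift j ord0).
  rewrite [X in X * _]s0 mul0r => /(_ _)/esym/eqP; rewrite normr_eq0 => d0.
  have := cell_unit (ndT K); rewrite unitmxE unitfE => /negP; case; apply: d0.
  by rewrite eq_sym neq_lift.
exact: ref_int_eq0.
Qed.

Lemma simplex_int_ge0 n k (p : 'I_k.+1 -> 'rV[R]_n) (g : 'rV[R]_n -> R) :
  (forall x, simplex p x -> 0 <= g x) -> 0 <= simplex_int p g.
Proof.
move=> g0; rewrite simplex_intE mulr_ge0 ?sqrtr_ge0//.
by apply: Rintegral_ge0 => t St; apply: g0; apply/simplexP; exists t.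
Qed.

Lemma deg_leD j (a b : poly) : deg_le j a -> deg_le j b -> deg_le j (a + b).
Proof.
move=> da db; rewrite /deg_le (leq_trans (mmeasureD_le _ _ _))//.
by rewrite geq_max; apply/andP.
Qed.

Lemma deg_leZ j c (a : poly) : deg_le j a -> deg_le j (c *: a).
Proof. by move=> da; rewrite /deg_le (leq_trans (mmeasureZ_le _ _ _)). Qed.

Lemma deg_le0 j : deg_le j (0 : poly).
Proof. by rewrite /deg_le mmeasure0. Qed.

Lemma deg_le_sum j (I : Type) (s : seq I) (P : pred I) (F : I -> poly) :
  (forall i, P i -> deg_le j (F i)) -> deg_le j (\sum_(i <- s | P i) F i).
Proof.
by move=> dF; elim/big_ind: _ => //; [exact: deg_le0|exact: deg_leD].
Qed.

Lemma deg_le_pderiv i j (a : poly) : (0 < j)%N -> deg_le j a -> deg_le j.-1 (pderiv i a).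
Proof.
move=> j0; rewrite /deg_le prednK// => da; rewrite mmeasureE.
apply/bigmax_leqP_seq => mm + _; rewrite mcoeff_msupp /pderiv mcoeff_deriv => nz.
have : mnm_add mm (mnm1 i) \in msupp a.
  by rewrite mcoeff_msupp; apply: contraNneq nz => ->; rewrite mul0rn.
move=> /mmeasure_mnm_lt => /(_ (@mdeg d.+1)) H.
have E : mdeg (mnm_add mm (mnm1 i)) = (mdeg mm).+1 by rewrite mdegD mdeg1 addn1.
have /= := leq_trans H da; rewrite ltnS => H'.
by rewrite /= -E.
Qed.

Lemma jump_polyOn e : polyOn m e (jump e).
Proof.
exists (\sum_(a : cell T * 'I_d.+2 | `[< face a.1 a.2 = e >])
    \sum_i outward_normal a.1 a.2 0 i *: U a.1 0 i).
  by apply: deg_le_sum => a _; apply: deg_le_sum => i _; apply: deg_leZ; exact: degU.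
move=> x _; rewrite /peval raddf_sum; apply: eq_bigr => a _.
rewrite raddf_sum; apply: eq_bigr => i _.
by rewrite [LHS]mulrC [vpeval _ _ _ _]mxE; apply/esym/mevalZ.
Qed.

Hypothesis bh0 : forall q, Qh0 Omega m q -> bh Omega m u q = 0.

Lemma peval0 (x : V) : peval (0 : poly) x = 0.
Proof. exact: meval0. Qed.

Lemma jump_eq0 (K : cell T) j x : face K j x -> jump (face K j) x = 0.
Proof.
pose q : wfun T R := Wfun (fun _ _ => 0) jump.
have C10 : C1 (fun _ : V => 0 : R).
  by rewrite (_ : (fun _ => _) = peval 0); [exact: peval_C1|apply/funext => y; rewrite peval0].
have Qq : Qh0 Omega m q.
  split=> [K'|e [K' [j' ->]]|]; last split.
  - by exists 0; [exact: deg_le0|move=> y _; rewrite peval0].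
  - exact: jump_polyOn.
  - by apply: (L2_piecewise intOmega hT (H := fun _ _ => 0)) => // K'; exact: cst_continuous.
  - rewrite (Rintegral_piecewise oOmega intOmega hT (H := fun _ _ => 0))//; last first.
      by move=> K'; exact: cst_continuous.
    rewrite big1// => K' _; rewrite /cell_int Rintegral_cst ?mul0r//.
    exact: measurable_elt.
have := bh0 Qq; rewrite (bhE (H := fun _ _ => 0) (h := fun K j => jump (face K j)))//; last first.
  by move=> K' j'; exact: continuous_jump.
rewrite big_split /= big1 => [|K' _]; last first.
  rewrite /cell_int; under eq_Rintegral do rewrite mul0r.
  by rewrite Rintegral_cst ?mul0r ?oppr0//; exact: measurable_elt.
rewrite add0r (sum_flux_jump continuous_jump).
have cjj e : continuous (fun y => jump e y * jump e y).
  by apply: continuous_mulr; exact: continuous_jump.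
have jj0 e y : 0 <= jump e y * jump e y by rewrite -expr2 sqr_ge0.
move=> /eqP; rewrite psumr_eq0 => [/allP S0|a _]; last first.
  by rewrite mulr_ge0 ?invr_ge0 ?ler0n//; apply: simplex_int_ge0 => y _; exact: jj0.
have := S0 (K, j) (mem_index_enum _); rewrite /= mulf_eq0 invr_eq0 pnatr_eq0.
(* The weight cannot vanish, since [(K, j)] itself is one of the incidences counted. *)
move=> /orP[/eqP/card0_eq/(_ (K, j))|/eqP s0 Kjx].
  by rewrite inE => /asboolP; case.
have := simplex_int_eq0 (cjj (face K j)) (fun y _ => jj0 _ y) s0 Kjx.
by move=> /eqP; rewrite mulf_eq0 orbb => /eqP.
Qed.

Lemma sum_flux_eq0 (psi : V -> R) : continuous psi ->
  \sum_K \sum_j simplex_int (fvtx K j) (fun x => psi x * flux K j x) = 0.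
Proof.
move=> cpsi; rewrite (sum_flux_jump (psi := fun=> psi))// big1// => a _.
rewrite /sint (eq_simplex_int (h := fun=> 0 * 0)).
  by rewrite simplex_intZ ?mul0r ?mulr0//; exact: cst_continuous.
by move=> x ax; rewrite jump_eq0// mul0r mulr0.
Qed.

Lemma green (K : cell T) (phi : V -> R) : C1 phi ->
  cell_int K (fun x => phi x * peval (Defs.pdiv (U K)) x) +
  cell_int K (fun x => dot (vpeval (U K) x) (grad phi x)) =
  \sum_j simplex_int (fvtx K j) (fun x => phi x * flux K j x).
Proof.
move=> C1phi; have [cphi _ cdphi] := C1phi.
have C1U i := peval_C1 (U K 0 i).
have mK := measurable_elt K.
have cgrad : continuous (fun x => dot (vpeval (U K) x) (grad phi x)).
  apply: continuous_sum => i; apply: continuous_mulr.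
    by under eq_fun do rewrite [vpeval _ _ _ _]mxE; exact: continuous_peval.
  by under eq_fun do rewrite [grad _ _ _ _]mxE; exact: cdphi.
have cdiv : continuous (fun x => phi x * peval (Defs.pdiv (U K)) x).
  by apply: continuous_mulr => //; exact: continuous_peval.
have ig g : continuous g -> (mu d.+1).-integrable (elt K) (EFin \o g).
  exact: integrable_simplex.
rewrite /cell_int -RintegralD//; try exact: ig.
transitivity (\sum_i cell_int K (partial i (fun x => phi x * peval (U K 0 i) x))).
  rewrite /cell_int -Rintegral_sum//; last first.
    by move=> i; apply: ig; have [_ _] := C1M C1phi (C1U i); exact.
  apply: eq_Rintegral => x _; rewrite /peval /Defs.pdiv raddf_sum mulr_sumr /dot -big_split /=.
  apply: eq_bigr => i _; rewrite (partialM _ _ C1phi (C1U i)) partial_peval.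
  by rewrite [vpeval _ _ _ _]mxE [grad _ _ _ _]mxE.
rewrite (eq_bigr _ (fun i _ => cell_int_partial (ndT K) i (C1M C1phi (C1U i)))).
rewrite exchange_big /=; apply: eq_bigr => j _.
rewrite -simplex_int_sum => [|i]; last first.
  apply: continuous_mulr; last exact: cst_continuous.
  by apply: continuous_mulr => //; exact: continuous_peval.
apply: eq_simplex_int => x _; rewrite /flux /dot mulr_sumr; apply: eq_bigr => i _.
by rewrite [vpeval _ _ _ _]mxE mulrA.
Qed.

Lemma pdiv_eq0 (K : cell T) x : elt K x -> peval (Defs.pdiv (U K)) x = 0.
Proof.
pose D (K : cell T) := peval (Defs.pdiv (U K)).
pose q : wfun T R := Wfun D (fun _ _ => 0).
have cD K' : continuous (D K') by exact: continuous_peval.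
have C11 : C1 (fun _ : V => 1 : R).
  rewrite (_ : (fun _ => _) = peval (1 : poly)); first exact: peval_C1.
  by apply/funext => y; rewrite /peval meval1.
have Qq : Qh0 Omega m q.
  split=> [K'|e _|]; last split.
  - exists (Defs.pdiv (U K')) => //.
    by apply: deg_le_sum => i _; apply: deg_le_pderiv => //; exact: degU.
  - by exists 0; [exact: deg_le0|move=> y _; rewrite peval0].
  - exact: (L2_piecewise intOmega hT (H := D)).
  - rewrite (Rintegral_piecewise oOmega intOmega hT (H := D))//.
    (* Mean zero: Green's formula with the constant 1 turns the integral of the divergence into the
       total flux, already known to vanish. *)
    rewrite -[RHS](sum_flux_eq0 (@cst_continuous _ _ (1 : R))).
    apply: eq_bigr => K' _; rewrite -(green K' C11).
    rewrite [X in _ = _ + X](_ : _ = 0).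
      by rewrite addr0; apply: eq_Rintegral => y _; rewrite mul1r.
    rewrite -[RHS](mul0r (fine (mu d.+1 (elt K')))) -Rintegral_cst; last exact: measurable_elt.
    apply: eq_Rintegral => y _.
    have -> : grad (fun _ : V => 1 : R) y = 0.
      by apply/rowP => i; rewrite !mxE; exact: derive_cst.
    by rewrite dotC dotE mul0mx mxE.
have := bh0 Qq; rewrite (bhE (H := D) (h := fun _ _ _ => 0))//; last 2 first.
- by move=> K'; exact: peval_C1.
- by move=> K' j; exact: cst_continuous.
have cDD K' : continuous (fun y => D K' y * D K' y) by exact: continuous_mulr.
have DD0 K' y : 0 <= D K' y * D K' y by rewrite -expr2 sqr_ge0.
rewrite (eq_bigr (fun K' => - cell_int K' (fun y => D K' y * D K' y))); last first.
  move=> K' _; rewrite [X in _ + X]big1 ?addr0// => j _.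
  rewrite (eq_simplex_int (h := fun=> 0 * 0)) => [|y _]; last by rewrite !mul0r.
  by rewrite simplex_intZ ?mul0r//; exact: cst_continuous.
move=> /eqP; rewrite sumrN oppr_eq0 psumr_eq0 => [/allP S0|K' _]; last first.
  by apply: Rintegral_ge0 => y _; exact: DD0.
move=> Kx; have /eqP S0K := S0 K (mem_index_enum _).
have := cell_int_eq0 (ndT K) (cDD K) (fun y _ => DD0 K y) S0K Kx.
by move=> /eqP; rewrite mulf_eq0 orbb => /eqP.
Qed.

Lemma weak_div_eq0 : weak_div Omega (piecewise (wi u)) (fun=> 0).
Proof.
move=> phi [/smooth_C1 C1phi _ _]; have [cphi _ cdphi] := C1phi.
have cgrad K : continuous (fun x => dot (vpeval (U K) x) (grad phi x)).
  apply: continuous_sum => i; apply: continuous_mulr.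
    by under eq_fun do rewrite [vpeval _ _ _ _]mxE; exact: continuous_peval.
  by under eq_fun do rewrite [grad _ _ _ _]mxE; exact: cdphi.
under [in RHS]eq_Rintegral do rewrite mul0r.
rewrite Rintegral_cst ?mul0r ?oppr0; last exact: open_measurable_rV.
transitivity (\int[mu d.+1]_(x in Omega)
    piecewise (fun K x => dot (wi u K x) (grad phi x)) x).
  apply: eq_Rintegral => x _.
  by rewrite /piecewise; case: pickP => // _; rewrite dotE mul0mx mxE.
rewrite (Rintegral_piecewise oOmega intOmega hT
  (H := fun K x => dot (vpeval (U K) x) (grad phi x)))//; last first.
  by move=> K x Kx; rewrite uU.
rewrite -[RHS](sum_flux_eq0 cphi); apply: eq_bigr => K _.
rewrite -(green K C1phi) [X in _ = X + _](_ : _ = 0); last first.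
  rewrite -[RHS](mul0r (fine (mu d.+1 (elt K)))) -Rintegral_cst; last exact: measurable_elt.
  by apply: eq_Rintegral => x /set_mem Kx; rewrite pdiv_eq0// mulr0.
by rewrite add0r; apply: eq_Rintegral => x /set_mem Kx; rewrite uU.
Qed.

Lemma Hdiv_piecewise : Hdiv Omega (piecewise (wi u)).
Proof.
split; last first.
  exists (fun=> 0); last exact: weak_div_eq0.
  rewrite (_ : (fun=> 0) = piecewise (fun (_ : cell T) (_ : V) => 0 : R)).
    by apply: (L2_piecewise intOmega hT (H := fun _ _ => 0)) => // K; exact: cst_continuous.
  by apply/funext => x; rewrite /piecewise; case: pickP.
move=> i; rewrite (_ : (fun x => _) = piecewise (fun K x => wi u K x 0 i)).
  apply: (L2_piecewise intOmega hT (H := fun K => peval (U K 0 i))).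
    by move=> K; exact: continuous_peval.
  by move=> K x Kx; rewrite uU// mxE.
by apply/funext => x; rewrite /piecewise; case: pickP => // _; rewrite mxE.
Qed.

End assembly.

(* The space dimension is d.+1. *)
Theorem theorem2p1 (R : realType) (d : nat) (hd : d.+1 = 2%N \/ d.+1 = 3%N)
    (Omega : set 'rV[R]_d.+1) (hOmega : lipschitz_polyhedral_domain Omega)
    (nu alpha r : R) (hnu : 0 < nu) (halpha : 0 < alpha) (hr : 2 <= r)
    (f : 'rV[R]_d.+1 -> 'rV[R]_d.+1) (hf : L2v Omega f)
    (T : mesh R d) (hT : partitions T Omega)
    (sigma : R) (hsigma : shape_regular T sigma)
    (m k : nat) (hm : (1 <= m)%N) (hk : k = m.-1 \/ k = m)
    (u : wfun T 'rV[R]_d.+1) (p : wfun T R)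
    (hsol : WG_solution Omega nu alpha r f m k u p) :
  Hdiv Omega (piecewise (wi u)) /\ weak_div Omega (piecewise (wi u)) (fun=> 0).
Proof.
have [[oO _ _] [_ lO _]] := hOmega.
have intO := interior_closure_lipschitz oO lO.
have [[uP _ _] _ _ bh0] := hsol.
have /choice[Uf UfP] : forall K : cell T, exists P : 'I_d.+1 -> mpoly.mpoly d.+1 R,
    forall i, deg_le m (P i) /\ forall x, elt K x -> wi u K x 0 i = peval (P i) x.
  move=> K; have /choice[P PP] : forall i, exists P : mpoly.mpoly d.+1 R,
      deg_le m P /\ forall x, elt K x -> wi u K x 0 i = peval P x.
    by move=> i; have [P dP PE] := uP K i; exists P.
  by exists P.
pose U K := \row_i Uf K i : 'rV[mpoly.mpoly d.+1 R]_d.+1.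
have degU K : vdeg_le m (U K) by move=> i; rewrite mxE; have [] := UfP K i.
have uU K x : elt K x -> wi u K x = vpeval (U K) x.
  by move=> Kx; apply/rowP => i; rewrite !mxE; have [_ ->] := UfP K i.
split; first exact: (Hdiv_piecewise oO intO hT hm degU uU bh0).
exact: (weak_div_eq0 oO intO hT hm degU uU bh0).
Qed.
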